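(* Let $h>0$ be fixed, let $u_0,v_0\in L^1(\mathbb{R}^N)\cap L^\infty(\mathbb{R}^N)$ and let $f,g$ be measurable on $Q_T$ with $\int_0^T\big(\|f(\cdot,t)\|_{L^1(\mathbb{R}^N)}+\|f(\cdot,t)\|_{L^\infty(\mathbb{R}^N)}\big)dt<\infty$ and likewise for $g$. Assume that the scheme (S) is admissible (as defined in the context), and let $U_h^j,V_h^j\in L^1(\mathbb{R}^N)\cap L^\infty(\mathbb{R}^N)$ be the a.e.-solutions of (S) with data $(u_0,f)$ and $(v_0,g)$ respectively. Then for every $j\in\{1,\dots,J\}$: (a) (Monotonicity) If $u_0\le v_0$ and $f\le g$ (a.e.), then $U_h^j\le V_h^j$ (a.e.). (b) ($L^1$-stability) $\|U_h^j\|_{L^1(\mathbb{R}^N)}\le\|u_0\|_{L^1(\mathbb{R}^N)}+\int_0^{t_j}\|f(\cdot,\tau)\|_{L^1(\mathbb{R}^N)}\,d\tau$. (c) ($L^\infty$-stability) $\|U_h^j\|_{L^\infty(\mathbb{R}^N)}\le\|u_0\|_{L^\infty(\mathbb{R}^N)}+\int_0^{t_j}\|f(\cdot,\tau)\|_{L^\infty(\mathbb{R}^N)}\,d\tau$. (d) (Conservativity) If in addition $\varphi_1^h$ is locally Lipschitz, then $$\int_{\mathbb{R}^N}U_h^j(x)\,dx=\int_{\mathbb{R}^N}u_0(x)\,dx+\int_0^{t_j}\int_{\mathbb{R}^N}f(x,\tau)\,dx\,d\tau.$$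
   Context: Let $N\in\mathbb{N}$, $T>0$, $Q_T=\mathbb{R}^N\times(0,T)$. Operators: for a nonnegative symmetric (i.e. $\nu(-B)=\nu(B)$) Radon measure $\nu$ on $\mathbb{R}^N\setminus\{0\}$ with finite total mass, write $\mathcal{L}^\nu[\psi](x)=\int(\psi(x+z)-\psi(x))\,d\nu(z)$ and $\nu(\mathbb{R}^N)$ for the total mass. When $\psi$ is only defined a.e., a Borel representative is used. Time grid: $0=t_0<t_1<\dots<t_J=T$ (possibly nonuniform), $\Delta t_j=t_j-t_{j-1}$, $\Delta t=\max_j\Delta t_j$, and $F^j(x)=\frac1{\Delta t_j}\int_{t_{j-1}}^{t_j}f(x,t)\,dt$. Scheme (S) with data $(u_0,f)$: $U_h^0=u_0$ and, for $j=1,\dots,J$, for a.e. $x\in\mathbb{R}^N$, $$U_h^j(x)=U_h^{j-1}(x)+\Delta t_j\Big(\mathcal{L}^{\nu_1^h}[\varphi_1^h(U_h^j)](x)+\mathcal{L}^{\nu_2^h}[\varphi_2^h(U_h^{j-1})](x)+F^j(x)\Big).$$ The scheme is called admissible if: $\nu_1^h,\nu_2^h$ are nonnegative symmetric Radon measures on $\mathbb{R}^N\setminus\{0\}$ with finite total mass; $\varphi_1^h:\mathbb{R}\to\mathbb{R}$ is nondecreasing and continuous; $\varphi_2^h:\mathbb{R}\to\mathbb{R}$ is nondecreasing and locally Lipschitz; and the CFL condition $\Delta t\,L_{\varphi_2^h}\,\nu_2^h(\mathbb{R}^N)\le1$ holds, where $L_{\varphi_2^h}$ is the Lipschitz constant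 of $\varphi_2^h$ on $[-M,M]$, and $M$ is the larger of $\|u_0\|_{L^\infty}+\int_0^T\|f(\cdot,\tau)\|_{L^\infty}d\tau$ and $\|v_0\|_{L^\infty}+\int_0^T\|g(\cdot,\tau)\|_{L^\infty}d\tau$. *)

(* Defs.v *)
From HB Require Import structures.
From mathcomp Require Import all_boot all_order all_algebra.
From mathcomp Require Import all_classical all_reals all_analysis.

Set Implicit Arguments.
Unset Strict Implicit.
Unset Printing Implicit Defensive.

Import Order.TTheory GRing.Theory Num.Theory.
Import numFieldNormedType.Exports.

Local Open Scope classical_set_scope.
Local Open Scope ring_scope.

(* R^n is 'rV[R]_n, with the sigma-algebra generated by the coordinate maps:
   this is the Borel sigma-algebra of R^n, since R is second countable. *)
Section measurable_rV.
Context (R : realType) (n : nat).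

Definition rV_coord (i : 'I_n) (x : 'rV[R]_n) : measurableTypeR R := x ord0 i.

Let rV_set0 : g_sigma_preimage rV_coord set0.
Proof. exact: sigma_algebra0. Qed.

Let rV_setC A : g_sigma_preimage rV_coord A -> g_sigma_preimage rV_coord (~` A).
Proof. exact: sigma_algebraC. Qed.

Let rV_bigcup (F : (set 'rV[R]_n)^nat) :
  (forall i, g_sigma_preimage rV_coord (F i)) ->
  g_sigma_preimage rV_coord (\bigcup_i (F i)).
Proof. exact: sigma_algebra_bigcup. Qed.

HB.instance Definition _ := @isMeasurable.Build default_measure_display
  'rV[R]_n (g_sigma_preimage rV_coord) rV_set0 rV_setC rV_bigcup.

End measurable_rV.

Lemma measurable_rV_coord (R : realType) (n : nat) (i : 'I_n) :
  measurable_fun [set: 'rV[R]_n] (rV_coord i).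
Proof.
move=> _ Y mY; rewrite setTI; apply: sub_sigma_algebra => /=.
rewrite -bigcup_seq/=; exists i => /=; first by rewrite mem_index_enum.
by exists Y => //; rewrite setTI.
Qed.

Lemma measurable_fun_rVP d (S : measurableType d) (R : realType) (n : nat)
    (f : S -> 'rV[R]_n) :
  (forall i, measurable_fun [set: S] (rV_coord i \o f)) ->
  measurable_fun [set: S] f.
Proof.
move=> mf _ A mA; rewrite setTI.
suff : g_sigma_preimage (@rV_coord R n) `<=` [set B | measurable (f @^-1` B)].
  by apply.
apply: smallest_sub; first split => /=.
- by rewrite preimage_set0.
- by move=> B mB; rewrite setTD preimage_setC; exact: measurableC.
- by move=> F mF; rewrite preimage_bigcup; exact: bigcupT_measurable.
rewrite -bigcup_seq; apply: bigcup_sub => i _ _ [C mC <-] /=.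
rewrite setTI -comp_preimage -[X in measurable X]setTI.
exact: mf.
Qed.

(* Lebesgue measure on R^n, by iterated products: the image of
   lebesgue_measure \x mu under (a, x) |-> (a, x_0, ..., x_(n-1)). *)
Section lebesgue_rV.
Context (R : realType).

Definition rV_cons n (p : measurableTypeR R * 'rV[R]_n) : 'rV[R]_n.+1 :=
  row_mx (p.1%:M : 'rV[R]_1) p.2.

Lemma rV_cons0 n p : @rV_cons n p ord0 ord0 = p.1.
Proof. by rewrite mxE; case: splitP => // j _; rewrite mxE !ord1 eqxx. Qed.

Lemma rV_consS n p (j : 'I_n) : rV_cons p ord0 (lift ord0 j) = p.2 ord0 j.
Proof.
rewrite mxE; case: splitP => [k|k [kj]]; first by rewrite ord1.
by congr (p.2 _ _); apply/val_inj; exact/esym/kj.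
Qed.

Lemma measurable_rV_cons n : measurable_fun setT (@rV_cons n).
Proof.
apply: measurable_fun_rVP => i; case: (unliftP ord0 i) => [j|] ->.
  rewrite (_ : _ \o _ = rV_coord j \o snd); last first.
    by apply/funext => p; rewrite /= /rV_coord rV_consS.
  by apply: measurableT_comp => //; exact: measurable_rV_coord.
rewrite (_ : _ \o _ = fst) //.
by apply/funext => p; rewrite /= /rV_coord rV_cons0.
Qed.

Section step.
Context (n : nat) (mu : {sigma_finite_measure set 'rV[R]_n -> \bar R}).

Definition lebesgue_rV_succ : set 'rV[R]_n.+1 -> \bar R :=
  pushforward (@lebesgue_measure R \x mu)%E (@rV_cons n).

Let lebesgue_rV_succ0 : lebesgue_rV_succ set0 = 0%E.
Proof. by rewrite /lebesgue_rV_succ /pushforward preimage_set0 measure0. Qed.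

Let lebesgue_rV_succ_ge0 A : (0 <= lebesgue_rV_succ A)%E.
Proof. by rewrite /lebesgue_rV_succ /pushforward; exact: measure_ge0. Qed.

Let lebesgue_rV_succ_sigma_additive : semi_sigma_additive lebesgue_rV_succ.
Proof.
pose m := [the {measure set _ -> \bar R} of (@lebesgue_measure R \x mu)%E].
have mcons B : measurable B -> measurable (@rV_cons n @^-1` B).
  by move=> mB; rewrite -[X in measurable X]setTI; exact: measurable_rV_cons.
move=> F mF tF mUF; rewrite /lebesgue_rV_succ /pushforward preimage_bigcup.
apply: (@measure_semi_sigma_additive _ _ _ m (fun k => @rV_cons n @^-1` F k)).
- by move=> k; exact: mcons.
- apply/trivIsetP => /= i j _ _ ij; rewrite -preimage_setI.
  by move/trivIsetP : tF => /(_ _ _ _ _ ij) ->//; rewrite preimage_set0.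
- by rewrite -preimage_bigcup; exact: mcons.
Qed.

HB.instance Definition _ := isMeasure.Build _ _ _ lebesgue_rV_succ
  lebesgue_rV_succ0 lebesgue_rV_succ_ge0 lebesgue_rV_succ_sigma_additive.

Let lebesgue_rV_succ_sigma_finite : sigma_finite setT lebesgue_rV_succ.
Proof.
have [F FT mF] : sigma_finite setT (@lebesgue_measure R \x mu)%E.
  have /sigma_finiteP[G [GT ndG Goo]] := sigma_finiteT (@lebesgue_measure R).
  have /sigma_finiteP[H [HT ndH Hoo]] := sigma_finiteT mu.
  exists (fun k => G k `*` H k).
    rewrite -setXTT GT HT predeqE => -[x y]; split.
      move=> [/= [k _ Gkx] [l _ Hly]]; exists (maxn k l) => //; split.
      - by move: x Gkx; exact/subsetPset/ndG/leq_maxl.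
      - by move: y Hly; exact/subsetPset/ndH/leq_maxr.
    by move=> [k _ []/= ? ?]; split; exists k.
  move=> k; have [? ?] := Goo k; have [? ?] := Hoo k.
  split; first exact: measurableX.
  by rewrite product_measure1E// lte_mul_pinfty// ge0_fin_numE.
pose uncons (x : 'rV[R]_n.+1) : measurableTypeR R * 'rV[R]_n :=
  (x ord0 ord0, \row_i x ord0 (lift ord0 i)).
have unconsK p : uncons (rV_cons p) = p.
  rewrite /uncons rV_cons0; case: p => a x; congr (_, _).
  by apply/rowP => i; rewrite mxE rV_consS.
have muncons : measurable_fun setT uncons.
  apply: measurable_fun_pair; first exact: (measurable_rV_coord ord0).
  apply: measurable_fun_rVP => i.
  rewrite (_ : _ \o _ = rV_coord (lift ord0 i)); first exact: measurable_rV_coord.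
  by apply/funext => x; rewrite /= /rV_coord mxE.
exists (fun k => uncons @^-1` F k); first by rewrite -preimage_bigcup -FT preimage_setT.
move=> k; have [mFk Fkoo] := mF k; split.
  by rewrite -[X in measurable X]setTI; exact: muncons.
rewrite /lebesgue_rV_succ /pushforward.
by rewrite (_ : _ @^-1` _ = F k)//; apply/seteqP; split => p /=; rewrite unconsK.
Qed.

HB.instance Definition _ := Measure_isSigmaFinite.Build _ _ _ lebesgue_rV_succ
  lebesgue_rV_succ_sigma_finite.

End step.

Fixpoint lebesgue_rV (n : nat) : {sigma_finite_measure set 'rV[R]_n -> \bar R} :=
  match n with
  | 0%N => \d_(0 : 'rV[R]_0)
  | k.+1 => lebesgue_rV_succ (lebesgue_rV k)
  end.

Lemma lebesgue_rV_box (n : nat) (A : 'I_n -> set (measurableTypeR R)) :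
  (forall i, measurable (A i)) ->
  lebesgue_rV n [set x | forall i, A i (x ord0 i)] =
  (\prod_(i < n) lebesgue_measure (A i))%E.
Proof.
elim: n A => [|n IH] A mA.
  rewrite big_ord0 /= diracE mem_set//=; by case.
rewrite big_ord_recl -IH//=.
rewrite /lebesgue_rV_succ /pushforward.
have mA' : measurable
    [set x : 'rV[R]_n | forall i, A (lift ord0 i) (x ord0 i)].
  have -> : [set x : 'rV[R]_n | forall i, A (lift ord0 i) (x ord0 i)] =
      \bigcap_(i in setT) (rV_coord i @^-1` A (lift ord0 i)).
    by apply/seteqP; split => x /= Hx i => [_|]; exact: Hx.
  apply: fin_bigcap_measurable; first exact: finite_finset.
  move=> i _; rewrite -[X in measurable X]setTI.
  exact: measurable_rV_coord.
rewrite -product_measure1E//.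
congr (_ _); apply/seteqP; split => [p /= Hp|p /= [H0 HS] i].
  split; first by have := Hp ord0; rewrite rV_cons0.
  by move=> i; have := Hp (lift ord0 i); rewrite rV_consS.
by case: (unliftP ord0 i) => [j|] ->; rewrite ?rV_cons0 ?rV_consS.
Qed.

End lebesgue_rV.

Section nonlocal_scheme.
Context (R : realType) (N : nat).

Local Notation mu := (lebesgue_rV R N).
Local Notation leb := (@lebesgue_measure R).

Definition L1_norm (u : 'rV[R]_N -> R) : \bar R := ('N[mu]_1[EFin \o u])%E.

Definition Linf_norm (u : 'rV[R]_N -> R) : \bar R := ('N[mu]_+oo[EFin \o u])%E.

(* Functions are Borel representatives of their classes. *)
Definition L1_Linf (u : 'rV[R]_N -> R) : Prop :=
  u \in Lfun mu 1%E /\ u \in Lfun mu +oo%E.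

(* f stands for a function on R^N x (0,T): its values at times outside (0,T)
   are never used. *)
Definition source_term (T : R) (f : 'rV[R]_N -> R -> R) : Prop :=
  measurable_fun ([set: 'rV[R]_N] `*` `]0, T[)
    (fun p : 'rV[R]_N * measurableTypeR R => f p.1 p.2) /\
  (\int[leb]_(s in `]0%R, T[) (L1_norm (f^~ s) + Linf_norm (f^~ s)) < +oo)%E.

(* A symmetric Radon measure of finite mass on R^N \ {0}, extended by zero to
   R^N: every finite Borel measure on R^N \ {0} is Radon. *)
Definition jump_measure (nu : {finite_measure set 'rV[R]_N -> \bar R}) : Prop :=
  nu [set 0] = 0%E /\
  forall B : set 'rV[R]_N, measurable B -> nu (-%R @` B) = nu B.

Definition jump_op (nu : {finite_measure set 'rV[R]_N -> \bar R})
    (psi : 'rV[R]_N -> R) (x : 'rV[R]_N) : R :=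
  \int[nu]_z (psi (x + z) - psi x).

Definition time_grid (T : R) (J : nat) (t : nat -> R) : Prop :=
  [/\ t 0%N = 0, t J = T & forall j, (j < J)%N -> t j < t j.+1].

(* Used for 1 <= j only. *)
Definition time_step (t : nat -> R) (j : nat) : R := t j - t j.-1.

(* The default value 0 does not matter: the steps of a time_grid are positive. *)
Definition max_time_step (J : nat) (t : nat -> R) : R :=
  \big[Num.max/0]_(1 <= j < J.+1) time_step t j.

Definition source_mean (t : nat -> R) (f : 'rV[R]_N -> R -> R) (j : nat)
    (x : 'rV[R]_N) : R :=
  (time_step t j)^-1 * \int[leb]_(s in `](t j.-1), (t j)[) f x s.

Definition scheme_solution (J : nat) (t : nat -> R)
    (nu1 nu2 : {finite_measure set 'rV[R]_N -> \bar R}) (phi1 phi2 : R -> R)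
    (u0 : 'rV[R]_N -> R) (f : 'rV[R]_N -> R -> R)
    (U : nat -> 'rV[R]_N -> R) : Prop :=
  [/\ forall j, (j <= J)%N -> L1_Linf (U j),
      (\forall x \ae mu, U 0%N x = u0 x) &
      forall j, (1 <= j <= J)%N -> \forall x \ae mu,
        U j x = U j.-1 x + time_step t j *
          (jump_op nu1 (phi1 \o U j) x + jump_op nu2 (phi2 \o U j.-1) x +
           source_mean t f j x)].

Definition locally_lipschitz (phi : R -> R) : Prop :=
  [locally [lipschitz phi r | r in setT]].

(* The least Lipschitz constant of phi on A, +oo if there is none. *)
Definition lipschitz_const (phi : R -> R) (A : set R) : \bar R :=
  ereal_inf [set k%:E | k in [set k : R | 0 <= k /\ k.-lipschitz_A phi]].

Definition sup_bound (T : R) (u0 : 'rV[R]_N -> R) (f : 'rV[R]_N -> R -> R) :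
    \bar R :=
  (Linf_norm u0 + \int[leb]_(s in `]0%R, T[) Linf_norm (f^~ s))%E.

Definition admissible (T : R) (J : nat) (t : nat -> R)
    (nu1 nu2 : {finite_measure set 'rV[R]_N -> \bar R}) (phi1 phi2 : R -> R)
    (u0 v0 : 'rV[R]_N -> R) (f g : 'rV[R]_N -> R -> R) : Prop :=
  let M := fine (Order.max (sup_bound T u0 f) (sup_bound T v0 g)) in
  let L := lipschitz_const phi2 `[- M, M] in
  [/\ jump_measure nu1 /\ jump_measure nu2,
      {homo phi1 : r s / r <= s} /\ continuous phi1,
      {homo phi2 : r s / r <= s} /\ locally_lipschitz phi2 &
      ((max_time_step J t)%:E * L * nu2 [set: 'rV[R]_N] <= 1)%E].

End nonlocal_scheme.

(* Main.v *)
Require Import Defs.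
From mathcomp Require Import all_boot all_order all_algebra.
From mathcomp Require Import all_classical all_reals all_analysis.
From mathcomp Require Import measurable_realfun ess_sup_inf ring lra.

Set Implicit Arguments.
Unset Strict Implicit.
Unset Printing Implicit Defensive.

Import Order.TTheory GRing.Theory Num.Theory.
Import numFieldNormedType.Exports.

Local Open Scope classical_set_scope.
Local Open Scope ring_scope.

(* The heart of the matter is a contraction for one step of the scheme: if
   (a', F) is mapped to a and (b', G) to b, then
     int (a - b)^+ <= int (a' - b')^+ + dt int (F - G)^+.
   In the implicit part, phi1 a - phi1 b need not be integrable, phi1 being
   merely continuous. Kato's inequality is therefore applied to
     eta = (phi1 a - phi1 b + d (a - b)^+ - d k)^+,
   which is integrable since phi1 is continuous at 0, and which is positive
   wherever a - b > k and only where a > b. By translation invariance the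
   nu1-average of eta (x + z) over z has the same integral in x as
   (mass nu1) eta, so these terms cancel; then d -> 0 and k -> 0. In the
   explicit part the CFL condition makes r |-> r - dt (mass nu2) phi2 r
   nondecreasing on [-M, M].

   The contraction only needs a^+ and b^- to be integrable, so that besides two
   solutions it also compares a solution with 0, which gives the L1 bound, and
   with the constants +- (||u0||_oo + int_0^(t_j) ||f||_oo), which gives the
   L-infinity bound; the latter in turn keeps the solutions in the range
   [-M, M] where the CFL condition is usable. *)

(** * Translation invariance of the Lebesgue measure *)

Section lebesgue_rV_translation.
Context (R : realType).
Local Notation leb := (@lebesgue_measure R).

(** A measure that agrees with the Lebesgue measure on half-open intervals is the Lebesgue measure,
    and a translate of []a, b]] is an interval of the same length. *)
Lemma lebesgue_measure_translation (c : R) (A : set (measurableTypeR R)) :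
  measurable A -> leb ((fun x : measurableTypeR R => x + c) @^-1` A) = leb A.
Proof.
have mc : measurable_fun [set: measurableTypeR R]
    (fun x => x + c : measurableTypeR R).
  exact: measurable_funD.
move=> mA; rewrite -[LHS]/(pushforward leb _ A).
apply/esym; apply: (lebesgue_measure_unique
  (mu := [the measure _ _ of pushforward leb _])) => //= _ [[a b]] _ <-.
rewrite /pushforward [X in leb X = _](_ : _ = `]a, b]%classic)//.
rewrite (_ : _ @^-1` _ = `](a - c), (b - c)]%classic); last first.
  by apply/seteqP; split=> x /=; rewrite !in_itv/= ltrBlDr lerBrDr.
by rewrite !lebesgue_measure_itv/= !lte_fin ltrD2r -!EFinB opprB addrA subrK.
Qed.

Lemma measurable_rV_add (n : nat) :
  measurable_fun setT (fun p : 'rV[R]_n * 'rV[R]_n => p.1 + p.2).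
Proof.
apply: measurable_fun_rVP => i.
rewrite (_ : _ \o _ = fun p => rV_coord i p.1 + rV_coord i p.2); last first.
  by apply/funext => p; rewrite /= /rV_coord mxE.
by apply: measurable_funD; apply: measurableT_comp;
  rewrite //; exact: measurable_rV_coord.
Qed.

Lemma measurable_rV_translation (n : nat) (z : 'rV[R]_n) :
  measurable_fun setT (fun x : 'rV[R]_n => x + z).
Proof. by have := measurable_fun_pair1 z (@measurable_rV_add n). Qed.

(** Read through [rV_cons], a translation in dimension [n.+1] is the product of a translation of the
    line and of one in dimension [n]; a product measure is determined by its values on
    rectangles. *)
Lemma lebesgue_rV_translation (n : nat) (z : 'rV[R]_n) (A : set 'rV[R]_n) :
  measurable A ->
  lebesgue_rV R n ((fun x => x + z) @^-1` A) = lebesgue_rV R n A.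
Proof.
elim: n z A => [|n IH] z A mA.
  congr (lebesgue_rV R 0 _); apply/seteqP.
  by split=> x /=; rewrite (thinmx0 (x + z)) (thinmx0 x).
rewrite /= /lebesgue_rV_succ /pushforward.
set m := (leb \x lebesgue_rV R n)%E.
pose z' : 'rV[R]_n := \row_i z ord0 (lift ord0 i).
pose s (p : measurableTypeR R * 'rV[R]_n) : measurableTypeR R * 'rV[R]_n :=
  (p.1 + z ord0 ord0, p.2 + z').
have ms : measurable_fun setT s.
  apply: measurable_fun_pair; first exact: measurable_funD.
  exact: (measurableT_comp (measurable_rV_translation _)).
have mB : measurable (@rV_cons R n @^-1` A).
  by rewrite -[X in measurable X]setTI; exact: measurable_rV_cons.
have -> : @rV_cons R n @^-1` ((fun x => x + z) @^-1` A) =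
          s @^-1` (@rV_cons R n @^-1` A).
  apply/seteqP; split=> p /=; set u := rV_cons _ + _; set v := rV_cons _;
    suff -> : u = v by []; apply/rowP => i; rewrite mxE;
    by case: (unliftP ord0 i) => [j|] ->; rewrite ?rV_cons0 ?rV_consS ?mxE.
rewrite -[LHS]/(pushforward m s _).
apply/esym; apply: (product_measure_unique
  (m' := [the measure _ _ of pushforward m s])) => // B C mB' mC.
rewrite /= /pushforward (_ : _ @^-1` _ =
  ((fun x : measurableTypeR R => x + z ord0 ord0) @^-1` B) `*`
  ((fun x => x + z') @^-1` C))//.
rewrite [LHS]product_measure1E//.
- congr (_ * _)%E; [exact: lebesgue_measure_translation|exact: IH].
- by rewrite -[X in measurable X]setTI; exact: measurable_funD.
- by rewrite -[X in measurable X]setTI; exact: measurable_rV_translation.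
Qed.

Lemma ge0_integral_rV_translation (n : nat) (z : 'rV[R]_n)
    (f : 'rV[R]_n -> \bar R) :
  measurable_fun setT f -> (forall x, (0 <= f x)%E) ->
  (\int[lebesgue_rV R n]_x f (x + z)%R = \int[lebesgue_rV R n]_x f x)%E.
Proof.
move=> mf f0; have mz := measurable_rV_translation z.
rewrite -[in LHS](preimage_setT (fun x => x + z)).
rewrite -(ge0_integral_pushforward mz)//.
by apply: eq_measure_integral => A mA _; exact: lebesgue_rV_translation.
Qed.

Lemma integral_rV_translation (n : nat) (z : 'rV[R]_n) (f : 'rV[R]_n -> \bar R) :
  measurable_fun setT f ->
  (\int[lebesgue_rV R n]_x f (x + z)%R = \int[lebesgue_rV R n]_x f x)%E.
Proof.
move=> mf; rewrite integralE [RHS]integralE.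
rewrite !(funepos_comp f (fun x => x + z)) !(funeneg_comp f (fun x => x + z)).
congr (_ - _)%E.
  apply: (ge0_integral_rV_translation z (f := (f^\+)%E)) => //.
  exact: measurable_funepos.
apply: (ge0_integral_rV_translation z (f := (f^\-)%E)) => //.
exact: measurable_funeneg.
Qed.

(** On a space of measure zero the norm of exponent [+oo] is 0 by convention; this excludes that
    case and identifies [Linf_norm] with an essential supremum. *)
Lemma lebesgue_rV_setT_gt0 (n : nat) : (0 < lebesgue_rV R n setT)%E.
Proof.
have -> : [set: 'rV[R]_n] =
    [set x : 'rV[R]_n | forall i, [set: measurableTypeR R] (x ord0 i)].
  by apply/seteqP; split.
rewrite (lebesgue_rV_box (A := fun=> setT))//.
elim/big_rec : _ => // i x _ x0; rewrite mule_gt0//.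
by rewrite -set_itvNyy lebesgue_measure_itv/= addye// ltry.
Qed.

End lebesgue_rV_translation.

(** * Jump operators on bounded functions *)

Section jump_operator.
Context (R : realType) (N : nat).
Local Notation mu := (lebesgue_rV R N).
Implicit Types (nu : {finite_measure set 'rV[R]_N -> \bar R}).
Implicit Types (u v w : 'rV[R]_N -> R).

(** The bound holds at every point rather than almost everywhere, so that each translate is
    integrable against a finite measure that may charge Lebesgue-null sets. *)
Definition bounded_mfun u :=
  measurable_fun setT u /\ exists K, forall x, `|u x| <= K.

Lemma bounded_mfunB u v :
  bounded_mfun u -> bounded_mfun v -> bounded_mfun (fun x => u x - v x).
Proof.
move=> [mu' [K uK]] [mv [L vL]]; split; first exact: measurable_funB.
by exists (K + L) => x; rewrite (le_trans (ler_normB _ _))// lerD.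
Qed.

Lemma bounded_mfunD u v :
  bounded_mfun u -> bounded_mfun v -> bounded_mfun (fun x => u x + v x).
Proof.
move=> [mu' [K uK]] [mv [L vL]]; split; first exact: measurable_funD.
by exists (K + L) => x; rewrite (le_trans (ler_normD _ _))// lerD.
Qed.

Lemma bounded_mfunZ (c : R) u : bounded_mfun u -> bounded_mfun (fun x => c * u x).
Proof.
move=> [mu' [K uK]]; split; first exact: measurable_funM.
by exists (`|c| * K) => x; rewrite normrM ler_wpM2l.
Qed.

Lemma bounded_mfun_cst (c : R) : bounded_mfun (fun=> c).
Proof. by split; [exact: measurable_cst|exists `|c|]. Qed.

Lemma bounded_mfun_max0 u :
  bounded_mfun u -> bounded_mfun (fun x => Num.max (u x) 0).
Proof.
move=> [mu' [K uK]]; split; first exact: measurable_maxr.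
exists K => x; have := uK x; rewrite !ler_norml => /andP[? ?].
by rewrite ge_max le_max; apply/and3P; split; lra.
Qed.

(** A monotone function is measurable, and on [[-K, K]] its values lie between those at the end
    points. *)
Lemma bounded_mfun_homo (phi : R -> R) u : {homo phi : r s / r <= s} ->
  bounded_mfun u -> bounded_mfun (phi \o u).
Proof.
move=> hphi [mu' [K uK]]; split.
  by apply: measurableT_comp => //; exact: nondecreasing_measurable.
exists (Num.max `|phi K| `|phi (- K)|) => x /=.
have /andP[Ku uK'] : - K <= u x <= K by rewrite -ler_norml.
have := hphi _ _ Ku; have := hphi _ _ uK'; move: (phi (u x)) => p.
have := ler_norm (phi K); have := lerNnormlW (lexx `|phi (- K)|).
rewrite le_max !ler_norml => *.
by have [p0|p0] := leP 0 p; apply/orP; [left|right]; apply/andP; split; lra.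
Qed.

Lemma integrable_rV_translate nu u (x : 'rV[R]_N) : bounded_mfun u ->
  nu.-integrable setT (fun z => (u (x + z))%:E).
Proof.
move=> [mu' [K uK]].
apply: (@measurable_bounded_integrable _ _ _ nu (fun z => u (x + z)) setT) => //.
- by rewrite -ge0_fin_numE// fin_num_measure.
- apply: (measurableT_comp mu'); apply: measurable_fun_rVP => i.
  rewrite (_ : _ \o _ = fun z => x ord0 i + rV_coord i z); last first.
    by apply/funext => z; rewrite /= /rV_coord mxE.
  by apply: measurable_funD => //; exact: measurable_rV_coord.
- exists K; split; first exact: num_real.
  by move=> L KL z _ /=; rewrite (le_trans (uK _))// ltW.
Qed.

(** The gain part of the jump operator, not normalised; the loss part is multiplication by the mass
    of [nu]. *)
Definition jump_mean nu u (x : 'rV[R]_N) : R := \int[nu]_z u (x + z).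

Lemma EFin_jump_mean nu u x : bounded_mfun u ->
  (jump_mean nu u x)%:E = (\int[nu]_z (u (x + z)%R)%:E)%E.
Proof.
move=> bu; rewrite /jump_mean /Rintegral fineK//.
exact/integrable_fin_num/integrable_rV_translate.
Qed.

Local Notation mass nu := (fine (nu [set: 'rV[R]_N])).

Lemma EFin_mass nu : (mass nu)%:E = nu setT.
Proof. by rewrite fineK// fin_num_measure. Qed.

Lemma mass_ge0 nu : 0 <= mass nu.
Proof. exact/fine_ge0/measure_ge0. Qed.

Lemma jump_opE nu u x : bounded_mfun u ->
  jump_op nu u x = jump_mean nu u x - mass nu * u x.
Proof.
move=> bu; rewrite /jump_op RintegralB//; last 2 first.
- exact: integrable_rV_translate.
- exact: finite_measure_integrable_cst.
by rewrite Rintegral_cst// mulrC.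
Qed.

Lemma jump_op_cst nu (c : R) x : jump_op nu (fun=> c) x = 0.
Proof.
rewrite /jump_op; under eq_Rintegral do rewrite subrr.
by rewrite Rintegral_cst// mul0r.
Qed.

(** The pointwise inequality is integrated in the increment [y - x] against [nu]. In Kato's
    inequality [w] is a truncation and [c] depends on values at the fixed point [x] only. *)
Lemma jump_opB_le nu u v w (c : R) (x : 'rV[R]_N) :
  bounded_mfun u -> bounded_mfun v -> bounded_mfun w ->
  (forall y, (u y - u x) - (v y - v x) <= w y + c) ->
  jump_op nu u x - jump_op nu v x <= jump_mean nu w x + mass nu * c.
Proof.
move=> bu bv bw uvw.
have icst k : nu.-integrable setT (fun=> k%:E) by exact: finite_measure_integrable_cst.
have ib u' : bounded_mfun u' -> nu.-integrable setT (fun z => (u' (x + z) - u' x)%:E).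
  move=> bu'.
  exact: (integrableB measurableT (integrable_rV_translate nu x bu') (icst (u' x))).
rewrite [leRHS](_ : _ = \int[nu]_z (w (x + z) + c)); last first.
  rewrite RintegralD//; first by rewrite Rintegral_cst// mulrC.
    exact: integrable_rV_translate.
  exact: icst.
rewrite -RintegralB//; [|exact: ib|exact: ib].
apply: le_Rintegral => //.
- exact: (integrableB measurableT (ib _ bu) (ib _ bv)).
- exact: (integrableD measurableT (integrable_rV_translate nu x bw) (icst c)).
Qed.

Lemma jump_mean_ge0 nu u x : (forall y, 0 <= u y) -> 0 <= jump_mean nu u x.
Proof. by move=> u0; exact: Rintegral_ge0. Qed.

Lemma measurable_rV_translate2 u : measurable_fun setT u ->
  measurable_fun setT (fun p : 'rV[R]_N * 'rV[R]_N => (u (p.1 + p.2))%:E).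
Proof.
move=> mu'; apply/measurable_EFinP.
exact: (measurableT_comp mu' (@measurable_rV_add R N)).
Qed.

Lemma measurable_jump_mean nu u : bounded_mfun u -> (forall y, 0 <= u y) ->
  measurable_fun setT (jump_mean nu u).
Proof.
move=> bu u0; apply/measurable_EFinP.
have -> : EFin \o jump_mean nu u = fun x => (\int[nu]_z (u (x + z)%R)%:E)%E.
  by apply/funext => x /=; rewrite EFin_jump_mean.
apply: (measurable_fun_fubini_tonelli_F
  (fun p : 'rV[R]_N * 'rV[R]_N => (u (p.1 + p.2))%:E)) => //.
- exact: measurable_rV_translate2 bu.1.
- by move=> p; rewrite lee_fin.
Qed.

(** By Tonelli [x] may be integrated first, and for fixed [z] translation invariance removes the
    shift. *)
Lemma ge0_integral_rV_translate2 nu (u : 'rV[R]_N -> \bar R) :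
  measurable_fun setT u -> (forall y, 0 <= u y)%E ->
  (\int[mu]_x \int[nu]_z u (x + z)%R = nu setT * \int[mu]_x u x)%E.
Proof.
move=> mu' u0.
rewrite (fubini_tonelli (fun p : 'rV[R]_N * 'rV[R]_N => u (p.1 + p.2)))//=; last first.
  exact: (measurableT_comp mu' (@measurable_rV_add R N)).
under eq_integral do rewrite ge0_integral_rV_translation//.
by rewrite integral_cst// muleC.
Qed.

Lemma ge0_integral_jump_mean nu u : bounded_mfun u -> (forall y, 0 <= u y) ->
  (\int[mu]_x (jump_mean nu u x)%:E = (mass nu)%:E * \int[mu]_x (u x)%:E)%E.
Proof.
move=> bu u0; rewrite EFin_mass; under eq_integral do rewrite EFin_jump_mean//.
apply: (ge0_integral_rV_translate2 nu (u := EFin \o u)).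
  by case: bu => mu' _; exact/measurable_EFinP.
by move=> y; rewrite lee_fin.
Qed.

(* A mu-null set is also missed, for almost every x, by nu-almost every
   translate x + z. *)
Lemma ae_eq_jump_op nu u v : measurable_fun setT u -> measurable_fun setT v ->
  (\forall x \ae mu, u x = v x) ->
  \forall x \ae mu, jump_op nu u x = jump_op nu v x.
Proof.
move=> mu' mv uv.
pose D (y : 'rV[R]_N) := `|u y - v y|%:E.
have mD : measurable_fun setT D.
  apply/measurable_EFinP; apply: measurableT_comp => //.
  exact: measurable_funB.
have D0 x : (0 <= D x)%E by rewrite lee_fin.
pose F (x : 'rV[R]_N) := (\int[nu]_z D (x + z)%R)%E.
have : (\int[mu]_x F x = 0)%E.
  rewrite /F (ge0_integral_rV_translate2 nu mD)//.
  rewrite (ae_eq_integral (cst 0%E))//; first by rewrite integral0 mule0.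
  by apply: filterS uv => x; rewrite /D => -> _; rewrite subrr normr0.
have mF : measurable_fun setT F.
  apply: (measurable_fun_fubini_tonelli_F
    (fun p : 'rV[R]_N * 'rV[R]_N => D (p.1 + p.2))) => //.
  exact: (measurableT_comp mD (@measurable_rV_add R N)).
under eq_integral do rewrite -[F _]gee0_abs ?integral_ge0//.
move/(ae_eq_integral_abs mu measurableT mF).
apply: filterS2 uv => x uvx /(_ I) /=.
have mx : measurable_fun setT (fun z : 'rV[R]_N => x + z).
  by have := measurable_fun_pair2 x (@measurable_rV_add R N).
have mDx : measurable_fun setT (fun z => D (x + z)).
  exact: (measurableT_comp mD mx).
rewrite /F; under eq_integral do rewrite -[D _]gee0_abs//.
move/(ae_eq_integral_abs nu measurableT mDx) => uvz.
rewrite /jump_op /Rintegral uvx; congr fine; apply: ae_eq_integral => //.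
- apply/measurable_EFinP/measurable_funB => //; exact: (measurableT_comp mu' mx).
- apply/measurable_EFinP/measurable_funB => //; exact: (measurableT_comp mv mx).
- apply: filterS uvz => z /(_ I)/eqP.
  by rewrite eqe normr_eq0 subr_eq0 => /eqP -> _.
Qed.

(** By Fubini and translation invariance the gain and the loss part have the same integral, the mass
    of [nu] times that of [u], and cancel. *)
Lemma integrable_jump_op nu u : bounded_mfun u ->
  mu.-integrable setT (EFin \o u) ->
  mu.-integrable setT (EFin \o jump_op nu u) /\
  (\int[mu]_x (jump_op nu u x)%:E = 0)%E.
Proof.
move=> bu iu.
pose h (p : 'rV[R]_N * 'rV[R]_N) := (u (p.1 + p.2))%:E.
have mh : measurable_fun setT h by exact: measurable_rV_translate2 bu.1.
have ih : (mu \x nu)%E.-integrable setT h.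
  apply/(integrable12ltyP _ _ mh) => /=.
  have mabs : measurable_fun setT (abse \o (EFin \o u)).
    by apply: measurableT_comp => //; case: bu => mu' _; exact/measurable_EFinP.
  have /= -> // := ge0_integral_rV_translate2 nu mabs.
  by move/integrableP : iu => [_ iu]; rewrite lte_mul_pinfty// fin_num_measure.
have imean : mu.-integrable setT (EFin \o jump_mean nu u).
  rewrite (_ : _ \o _ = fubini_F nu h); first exact: integrable_fubini_F.
  by apply/funext => x /=; rewrite EFin_jump_mean.
have icst : mu.-integrable setT (fun x => (mass nu)%:E * (u x)%:E)%E.
  exact: integrableZl.
have E : EFin \o jump_op nu u =
    (fun x => (jump_mean nu u x)%:E - (mass nu)%:E * (u x)%:E)%E.
  by apply/funext => x /=; rewrite jump_opE// EFinB EFinM.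
split; first by rewrite E; exact: integrableB.
rewrite -[LHS]/(\int[mu]_x (EFin \o jump_op nu u) x)%E E integralB//.
rewrite integralZl//.
under eq_integral do rewrite EFin_jump_mean//.
rewrite -[X in (X - _)%E]/(\int[mu]_x \int[nu]_z h (x, z))%E Fubini//=.
rewrite (eq_integral (fun=> \int[mu]_x (u x)%:E)%E); last first.
  move=> z _; apply: (integral_rV_translation z (f := EFin \o u)).
  exact: measurable_int iu.
rewrite integral_cst// EFin_mass muleC subee//.
by rewrite fin_numM// ?fin_num_measure// integrable_fin_num.
Qed.

End jump_operator.

(** * One-step contraction *)

Section truncation_limits.
Context d (T : measurableType d) (R : realType).
Variable mu : {measure set T -> \bar R}.
Implicit Types (u v : T -> R).

(** Monotone convergence along the thresholds [k = 1 / (n + 1)]: the truncations increase to the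
    positive part of [u] as [k] decreases to 0. *)
Lemma integral_max0_le u (B : \bar R) : measurable_fun setT u ->
  (forall k, 0 < k -> (\int[mu]_x (Num.max (u x - k) 0)%:E <= B)%E) ->
  (\int[mu]_x (Num.max (u x) 0)%:E <= B)%E.
Proof.
move=> mu' uB.
pose g n x := (Num.max (u x - harmonic n) 0)%:E.
have gu x : g ^~ x @ \oo --> (Num.max (u x) 0)%:E.
  apply: cvg_EFin; first exact: nearW.
  apply/cvgrPdist_le => e e0.
  have /cvgrPdist_le /(_ _ e0) := @cvg_harmonic R.
  apply: filterS => n; rewrite sub0r normrN ger0_norm ?harmonic_ge0//.
  rewrite -[(fine \o _) n]/(Num.max (u x - harmonic n) 0).
  have := @harmonic_ge0 R n; move: (harmonic n) => h h0 he.
  rewrite ler_norml; case: (leP (u x) 0) => ?; case: (leP (u x - h) 0) => ?;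
  by apply/andP; split; lra.
have -> : (\int[mu]_x (Num.max (u x) 0)%:E = \int[mu]_x limn (g ^~ x))%E.
  by apply: eq_integral => x _; apply/esym/cvg_lim.
have mg n : measurable_fun setT (g n).
  by apply/measurable_EFinP/measurable_maxr => //; exact: measurable_funB.
have g0 n x : setT x -> (0 <= g n x)%E by move=> _; rewrite lee_fin le_max lexx orbT.
have ndg x : setT x -> nondecreasing_seq (g ^~ x).
  move=> _ m n mn; rewrite lee_fin.
  rewrite ge_max !le_max lexx orbT andbT lerD2l lerN2.
  by rewrite /= lef_pV2 ?posrE ?ltr0n// ler_nat ltnS mn.
have cvgI := cvg_monotone_convergence measurableT mg g0 ndg (mu := mu).
rewrite -(cvg_lim _ cvgI)//; apply: lime_le; first by apply/cvg_ex; eexists; exact: cvgI.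
by apply: nearW => n; exact/uB/harmonic_gt0.
Qed.

Lemma ge0_le_integrable u v : measurable_fun setT u ->
  (forall x, 0 <= u x <= v x) ->
  mu.-integrable setT (EFin \o v) -> mu.-integrable setT (EFin \o u).
Proof.
move=> mu' uv; apply: le_integrable => //; first exact/measurable_EFinP.
move=> x _ /=; have /andP[u0 uvx] := uv x.
by rewrite lee_fin !ger0_norm// (le_trans u0).
Qed.

Lemma integrableDr u v : mu.-integrable setT (EFin \o u) ->
  mu.-integrable setT (EFin \o v) ->
  mu.-integrable setT (fun x => (u x + v x)%:E).
Proof. exact: integrableD. Qed.

Lemma integrableZr_EFin (c : R) u : mu.-integrable setT (EFin \o u) ->
  mu.-integrable setT (fun x => (c * u x)%:E).
Proof. exact: integrableZl. Qed.

End truncation_limits.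

(** Continuity at 0 gives the error [e] on some [[0, r[]; from [r] on, the total rise
    [phi K - phi 0] is at most [C * s] with [C = (phi K - phi 0) / r]. This stands in for a
    Lipschitz bound when [phi] is only continuous. *)
Lemma homo_affine_bound (R : realType) (phi : R -> R) (K e : R) :
  {homo phi : r s / r <= s} -> {for 0, continuous phi} -> 0 <= K -> 0 < e ->
  exists2 C, 0 <= C & forall s, 0 <= s <= K -> phi s - phi 0 <= e + C * s.
Proof.
move=> hphi cphi K0 e0.
have /cvgrPdist_lt/(_ _ e0) := cphi.
rewrite near_simpl => -[r /= r0 rphi].
have C0 : 0 <= (phi K - phi 0) / r.
  by apply: divr_ge0; [rewrite subr_ge0 hphi|exact: ltW].
exists ((phi K - phi 0) / r) => // s /andP[s0 sK].
have [sr|rs] := ltP s r.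
  have : `|phi 0 - phi s| < e by apply: rphi; rewrite /= sub0r normrN ger0_norm.
  rewrite distrC => /ltr_normlW/ltW/le_trans; apply.
  by rewrite lerDl mulr_ge0.
rewrite (@le_trans _ _ (phi K - phi 0))//; first by rewrite lerD2r hphi.
rewrite -[leLHS]add0r; apply: lerD; first exact: ltW.
rewrite mulrAC ler_pdivlMr// ler_wpM2l//.
by rewrite subr_ge0 hphi.
Qed.

(* With [psi = phi1 a - phi1 b], [wp = (a - b)^+] and
   [eta = (psi + d wp - d k)^+], a point where [eta > 0] is a point where
   [a > b], and there Kato's inequality bounds the jump of [psi]; elsewhere
   [a - b <= k], and the left-hand side vanishes up to the explicit part. *)
Lemma kato_bound (R : realType)
    (t w w' F D1 D2 k d psi eta psi' m1 m2 me mp : R) :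
  0 < t -> 0 < k -> 0 < d -> 0 <= m1 -> 0 <= m2 -> 0 <= me -> 0 <= mp ->
  w = w' + t * (D1 + D2 + F) ->
  (0 < w -> 0 <= psi) -> (w <= 0 -> psi <= 0) ->
  eta = Num.max (psi + d * Num.max w 0 - d * k) 0 ->
  (0 < eta -> D1 <= me + m1 * (d * Num.max w 0 - eta)) ->
  D2 <= mp + m2 * (- psi') ->
  (0 <= w' -> 0 <= psi') -> (w' <= 0 -> psi' <= 0) ->
  t * m2 * `|psi'| <= `|w'| ->
  Num.max (w - k) 0 + t * m1 * eta + t * m2 * Num.max psi' 0 <=
  Num.max w' 0 + t * Num.max F 0 + t * me + t * m1 * d * Num.max w 0 + t * mp.
Proof.
move=> t0 k0 d0 m10 m20 me0 mp0 wE wpos wneg etaE D1E D2E w'pos w'neg cfl.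
(* The CFL condition enters here: [t * m2 * psi'] is at most [w'] in absolute value and has a
   compatible sign, so subtracting it from [w'] does not reverse the sign of [w']. *)
have cfl' : t * m2 * Num.max psi' 0 <= Num.max w' 0 /\
    w' - t * m2 * psi' <= Num.max w' 0 - t * m2 * Num.max psi' 0.
  have [w'0|w'0] := leP 0 w'.
    by move: cfl; rewrite (max_l (w'pos w'0)) !ger0_norm// ?w'pos// => ->.
  move: cfl; have psi'0 := w'neg (ltW w'0).
  rewrite (ltr0_norm w'0) (ler0_norm psi'0) (max_r psi'0).
  by rewrite !mulr0 mulrN => ?; split; lra.
have tF : t * F <= t * Num.max F 0 by rewrite ler_pM2l// le_max lexx.
have t0' := ltW t0; have d0' := ltW d0.
have tF0 : 0 <= t * Num.max F 0 by rewrite mulr_ge0// le_max lexx orbT.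
have tme : 0 <= t * me by rewrite mulr_ge0.
have tmp : 0 <= t * mp by rewrite mulr_ge0.
have tm1 : 0 <= t * m1 by rewrite mulr_ge0.
have twp : 0 <= t * m1 * d * Num.max w 0.
  by rewrite mulr_ge0 ?le_max ?lexx ?orbT// mulr_ge0.
(* Where [eta > 0], also [w > 0], and the Kato bound on [D1] is inserted in the scheme; its term
   [- t * m1 * eta] goes to the left-hand side. *)
have [eta0|eta0] := ltP 0 eta.
  have w0 : 0 < w.
    rewrite ltNge; apply/negP => w0; move: eta0.
    rewrite etaE (max_r w0) mulr0 addr0 max_r ?ltxx//.
    by have := wneg w0; have := mulr_gt0 d0 k0; lra.
  have tD1 : t * D1 <= t * me + t * m1 * d * w - t * m1 * eta.
    have := D1E eta0; rewrite (max_l (ltW w0)) -(ler_pM2l t0) => /le_trans; apply.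
    by rewrite le_eqVlt; apply/orP; left; apply/eqP; ring.
  have tD2 : t * D2 <= t * mp - t * m2 * psi'.
    move: D2E; rewrite -(ler_pM2l t0) => /le_trans; apply.
    by rewrite le_eqVlt; apply/orP; left; apply/eqP; ring.
  have wk : Num.max (w - k) 0 <= w by rewrite ge_max; apply/andP; split; lra.
  have wE' : w = w' + t * D1 + t * D2 + t * F by rewrite wE; ring.
  rewrite (max_l (ltW w0)) in twp *; lra.
(* Where [eta = 0], [w > k] is impossible: [psi >= 0] and [d * (w - k) > 0] would make [eta]
   positive. Only the explicit term is left, and the CFL condition bounds it. *)
have {}eta0 : eta = 0.
  by apply/eqP; rewrite eq_le eta0 etaE le_max lexx orbT.
have wk : Num.max (w - k) 0 = 0.
  rewrite max_r// leNgt; apply/negP => wk; have w0 : 0 < w by lra.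
  have := wpos w0 => psi0.
  have : d * (w - k) <= 0.
    rewrite -eta0 etaE (max_l (ltW w0)) le_max; apply/orP; left.
    by rewrite mulrBr; lra.
  by rewrite leNgt mulr_gt0.
by rewrite wk eta0 mulr0; lra.
Qed.

Section step_contraction.
Context (R : realType) (N : nat).
Local Notation mu := (lebesgue_rV R N).
Local Notation mass nu := (fine (nu [set: 'rV[R]_N])).
Context (nu1 nu2 : {finite_measure set 'rV[R]_N -> \bar R}) (phi1 phi2 : R -> R).
Context (tau : R) (a b a' b' F G : 'rV[R]_N -> R).
Hypothesis tau0 : 0 < tau.
Hypothesis hphi1 : {homo phi1 : r s / r <= s}.
Hypothesis cphi1 : {for 0, continuous phi1}.
Hypothesis hphi2 : {homo phi2 : r s / r <= s}.
Hypotheses (ba : bounded_mfun a) (bb : bounded_mfun b).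
Hypotheses (ba' : bounded_mfun a') (bb' : bounded_mfun b').
Hypotheses (mF : measurable_fun setT F) (mG : measurable_fun setT G).
Hypothesis ia : mu.-integrable setT (fun x => (Num.max (a x) 0)%:E).
Hypothesis ib : mu.-integrable setT (fun x => (Num.max (- b x) 0)%:E).
Hypothesis ia' : mu.-integrable setT (fun x => (Num.max (a' x) 0)%:E).
Hypothesis ib' : mu.-integrable setT (fun x => (Num.max (- b' x) 0)%:E).
Hypothesis cfl : \forall x \ae mu,
  tau * mass nu2 * `|phi2 (a' x) - phi2 (b' x)| <= `|a' x - b' x|.
Hypothesis aE : \forall x \ae mu, a x = a' x +
  tau * (jump_op nu1 (phi1 \o a) x + jump_op nu2 (phi2 \o a') x + F x).
Hypothesis bE : \forall x \ae mu, b x = b' x +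
  tau * (jump_op nu1 (phi1 \o b) x + jump_op nu2 (phi2 \o b') x + G x).

Let wp x := Num.max (a x - b x) 0.
Let psi x := phi1 (a x) - phi1 (b x).
Let psip x := Num.max (phi2 (a' x) - phi2 (b' x)) 0.
Let eta d k x := Num.max (psi x + d * wp x - d * k) 0.

Let bwp : bounded_mfun wp.
Proof. exact/bounded_mfun_max0/bounded_mfunB. Qed.

Let bpsip : bounded_mfun psip.
Proof. by apply: bounded_mfun_max0; apply: bounded_mfunB; exact: bounded_mfun_homo. Qed.

Let beta d k : bounded_mfun (eta d k).
Proof.
apply: bounded_mfun_max0; apply: bounded_mfunB; last exact: bounded_mfun_cst.
apply: bounded_mfunD; last exact: bounded_mfunZ.
by apply: bounded_mfunB; exact: bounded_mfun_homo.
Qed.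

(** The majorant is [u^+ + v^-], so integrability of one part of each function suffices. *)
Let integrable_max0B (u v : 'rV[R]_N -> R) : bounded_mfun u -> bounded_mfun v ->
  mu.-integrable setT (fun x => (Num.max (u x) 0)%:E) ->
  mu.-integrable setT (fun x => (Num.max (- v x) 0)%:E) ->
  mu.-integrable setT (fun x => (Num.max (u x - v x) 0)%:E).
Proof.
move=> bu bv iu iv.
apply: (ge0_le_integrable (v := fun x => Num.max (u x) 0 + Num.max (- v x) 0)).
- by have [] := bounded_mfun_max0 (bounded_mfunB bu bv).
- move=> x; rewrite le_max lexx orbT/= ge_max addr_ge0 ?le_max ?lexx ?orbT// andbT.
  by rewrite lerD// le_max lexx.
- exact: integrableDr.
Qed.

Let iwp : mu.-integrable setT (EFin \o wp).
Proof. exact: integrable_max0B. Qed.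

(** Up to an error [d * k / 2] each, [phi1 a - phi1 0] and [phi1 0 - phi1 b] are bounded by
    multiples of [a^+] and [b^-]; the term [- d * k] in [eta] absorbs the two errors. *)
Let ieta d k : 0 < d -> 0 < k -> mu.-integrable setT (EFin \o eta d k).
Proof.
move=> d0 k0; have e0 : 0 < d * k / 2 by rewrite divr_gt0// mulr_gt0.
have [_ [Ka aK]] := ba; have [_ [Kb bK]] := bb.
have Ka0 : 0 <= Ka by exact: le_trans (aK 0).
have Kb0 : 0 <= Kb by exact: le_trans (bK 0).
have [C C0 phiC] := homo_affine_bound hphi1 cphi1 Ka0 e0.
(* Reflecting [phi1] through the origin turns the lower bound needed for [phi1 b] into an upper
   bound at [- b]. *)
have hN : {homo (fun s => - phi1 (- s)) : r s / r <= s}.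
  by move=> r s rs; rewrite lerN2 hphi1// lerN2.
have cN : {for 0, continuous (fun s => - phi1 (- s))}.
  apply: continuousN; apply: (@continuous_comp _ _ _ (-%R : R -> R) phi1).
    exact: opp_continuous.
  by rewrite oppr0.
have [D D0 phiD] := homo_affine_bound hN cN Kb0 e0.
pose v x := C * Num.max (a x) 0 + D * Num.max (- b x) 0 + d * wp x.
apply: (ge0_le_integrable (v := v)); first by have [] := beta d k.
  move=> x; rewrite /eta le_max lexx orbT/= ge_max.
  have a0 : 0 <= Num.max (a x) 0 <= Ka.
    rewrite le_max lexx orbT/= ge_max Ka0 andbT.
    exact: le_trans (ler_norm _) (aK x).
  have b0 : 0 <= Num.max (- b x) 0 <= Kb.
    rewrite le_max lexx orbT/= ge_max Kb0 andbT.
    by rewrite (le_trans _ (bK x))// -normrN ler_norm.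
  have wp0 : 0 <= wp x by rewrite /wp le_max lexx orbT.
  have v0 : 0 <= v x.
    have [/andP[? _] /andP[? _]] := (a0, b0).
    by rewrite /v !addr_ge0// mulr_ge0// ltW.
  rewrite v0 andbT.
  have := phiC _ a0; have := phiD _ b0; rewrite oppr0.
  have : phi1 (a x) <= phi1 (Num.max (a x) 0) by rewrite hphi1// le_max lexx.
  have : phi1 (- Num.max (- b x) 0) <= phi1 (b x).
    by rewrite hphi1// lerNl le_max lexx.
  by rewrite /v /psi; lra.
apply: integrableDr; last exact: integrableZr_EFin.
by apply: integrableDr; exact: integrableZr_EFin.
Qed.

Let step_pointwise d k : 0 < d -> 0 < k -> \forall x \ae mu,
  Num.max (a x - b x - k) 0 + tau * mass nu1 * eta d k x +
    tau * mass nu2 * psip x <=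
  Num.max (a' x - b' x) 0 + tau * Num.max (F x - G x) 0 +
    tau * jump_mean nu1 (eta d k) x + tau * mass nu1 * d * wp x +
    tau * jump_mean nu2 psip x.
Proof.
move=> d0 k0; apply: filterS3 cfl aE bE => x cflx aEx bEx.
have eta0 y : 0 <= eta d k y by rewrite /eta le_max lexx orbT.
have psip0 y : 0 <= psip y by rewrite /psip le_max lexx orbT.
have wp0 y : 0 <= wp y by rewrite /wp le_max lexx orbT.
apply: (@kato_bound _ tau _ _ (F x - G x)
  (jump_op nu1 (phi1 \o a) x - jump_op nu1 (phi1 \o b) x)
  (jump_op nu2 (phi2 \o a') x - jump_op nu2 (phi2 \o b') x)
  k d (psi x) (eta d k x) (phi2 (a' x) - phi2 (b' x))) => //.
- exact: mass_ge0.
- exact: mass_ge0.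
- exact: jump_mean_ge0.
- exact: jump_mean_ge0.
- by rewrite aEx bEx; ring.
- by rewrite subr_gt0 subr_ge0 => /ltW; exact: hphi1.
- by rewrite !subr_le0; exact: hphi1.
(* As [eta d k x > 0], the maximum at [x] is attained by its first argument, which at [y] is still a
   lower bound of [eta d k y]. In the difference [d * k] drops out, and [d * wp y >= 0] is
   discarded. *)
- move=> etax; apply: jump_opB_le; [exact: bounded_mfun_homo..|exact: beta|].
  have etaE : eta d k x = psi x + d * wp x - d * k.
    move: etax; rewrite /eta.
    by case: (leP (psi x + d * wp x - d * k) 0) => //; rewrite ltxx.
  move=> y /=; rewrite etaE -/(wp x).
  have : psi y + d * wp y - d * k <= eta d k y by rewrite /eta le_max lexx.
  have : 0 <= d * wp y by rewrite mulr_ge0// ltW.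
  by rewrite /psi; lra.
- apply: jump_opB_le; [exact: bounded_mfun_homo..|exact: bpsip|].
  move=> y /=; rewrite /psip.
  by have : phi2 (a' y) - phi2 (b' y) <= Num.max (phi2 (a' y) - phi2 (b' y)) 0;
    [rewrite le_max lexx|lra].
- by rewrite !subr_ge0; exact: hphi2.
- by rewrite !subr_le0; exact: hphi2.
Qed.

Let I u := (\int[mu]_x (u x)%:E)%E.

Let integralD_EFin (u v : 'rV[R]_N -> R) :
  measurable_fun setT u -> measurable_fun setT v ->
  (forall x, 0 <= u x) -> (forall x, 0 <= v x) ->
  I (fun x => u x + v x) = (I u + I v)%E.
Proof.
move=> mu' mv u0 v0; rewrite /I; under eq_integral do rewrite EFinD.
by rewrite ge0_integralD// => [x _||x _|]; rewrite ?lee_fin//; exact/measurable_EFinP.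
Qed.

Let integralZ_EFin (c : R) (u : 'rV[R]_N -> R) : measurable_fun setT u ->
  0 <= c -> (forall x, 0 <= u x) -> I (fun x => c * u x) = (c%:E * I u)%E.
Proof.
move=> mu' c0 u0; rewrite /I; under eq_integral do rewrite EFinM.
by rewrite ge0_integralZl_EFin// => [x _|]; rewrite ?lee_fin//; exact/measurable_EFinP.
Qed.

(** Once [step_pointwise] is integrated, the averages of [eta] and [psip] on the right equal the
    loss terms [H] and [X] on the left. These are finite, so they cancel. *)
Let step_integral d k : 0 < d -> 0 < k ->
  (I (fun x => Num.max (a x - b x - k)%R 0%R) <=
   I (fun x => Num.max (a' x - b' x)%R 0%R) +
   I (fun x => tau * Num.max (F x - G x) 0)%R +
   (tau * mass nu1 * d)%:E * I wp)%E.
Proof.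
move=> d0 k0.
have max0 (u : 'rV[R]_N -> R) x : 0 <= Num.max (u x) 0 by rewrite le_max lexx orbT.
have eta0 y : 0 <= eta d k y by rewrite /eta le_max lexx orbT.
have psip0 y : 0 <= psip y by rewrite /psip le_max lexx orbT.
have wp0 y : 0 <= wp y by rewrite /wp le_max lexx orbT.
have m10 : 0 <= tau * mass nu1 by rewrite mulr_ge0 ?mass_ge0// ltW.
have m20 : 0 <= tau * mass nu2 by rewrite mulr_ge0 ?mass_ge0// ltW.
have m1d0 : 0 <= tau * mass nu1 * d by rewrite mulr_ge0// ltW.
have mk : measurable_fun setT (fun x => Num.max (a x - b x - k) 0).
  have [] // := bounded_mfun_max0
    (bounded_mfunB (bounded_mfunB ba bb) (bounded_mfun_cst N k)).
have mw' : measurable_fun setT (fun x => Num.max (a' x - b' x) 0).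
  by have [] := bounded_mfun_max0 (bounded_mfunB ba' bb').
have meta := (beta d k).1; have mpsip := bpsip.1; have mwp := bwp.1.
have mmaxFG : measurable_fun setT (fun x => Num.max (F x - G x) 0).
  by apply: measurable_maxr => //; exact: measurable_funB.
have maxFG0 x : 0 <= Num.max (F x - G x) 0 by rewrite le_max lexx orbT.
have mFG : measurable_fun setT (fun x => tau * Num.max (F x - G x) 0).
  exact: measurable_funM.
have t0 := ltW tau0.
have FG0 x : 0 <= tau * Num.max (F x - G x) 0.
  exact: mulr_ge0.
have mj1 := measurable_jump_mean nu1 (beta d k) eta0.
have mj2 := measurable_jump_mean nu2 bpsip psip0.
have j10 x : 0 <= jump_mean nu1 (eta d k) x by exact: jump_mean_ge0.
have j20 x : 0 <= jump_mean nu2 psip x by exact: jump_mean_ge0.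
have mZ c (u : 'rV[R]_N -> R) :
  measurable_fun setT u -> measurable_fun setT (fun x => c * u x).
  by move=> ?; exact: measurable_funM.
have Z0 c (u : 'rV[R]_N -> R) : 0 <= c -> (forall x, 0 <= u x) ->
  forall x, 0 <= c * u x by move=> *; exact: mulr_ge0.
pose X := ((tau * mass nu2)%:E * I psip)%E.
pose H := ((tau * mass nu1)%:E * I (eta d k))%E.
(* The CFL condition bounds [tau * mass nu2 * psip] by [(a' - b')^+], which is integrable. *)
have Xfin : X \is a fin_num.
  rewrite ge0_fin_numE; last first.
    by apply: mule_ge0; rewrite ?lee_fin//; apply: integral_ge0 => x _; rewrite lee_fin.
  have /integrable_lty := integrable_max0B ba' bb' ia' ib'.
  move=> /(_ measurableT); apply: le_lt_trans.
  rewrite /X -integralZ_EFin//; apply: ae_ge0_le_integral => //.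
  - by move=> x _; rewrite lee_fin; exact: Z0.
  - by apply/measurable_EFinP; exact: mZ.
  - by move=> x _; rewrite lee_fin le_max lexx orbT.
  - exact/measurable_EFinP.
  apply: filterS cfl => x cflx _; rewrite lee_fin /psip.
  have [p0|p0] := leP (phi2 (a' x) - phi2 (b' x)) 0.
    by rewrite mulr0 le_max lexx orbT.
  have w0 : 0 < a' x - b' x.
    rewrite subr_gt0 ltNge; apply/negP => /hphi2 ?.
    by move: p0; rewrite subr_gt0 ltNge => /negP; apply.
  by move: cflx; rewrite !gtr0_norm// => /le_trans; apply; rewrite le_max lexx.
have Hfin : H \is a fin_num.
  by rewrite fin_numM//; apply: integrable_fin_num => //; exact: ieta.
have ks0 x : 0 <= Num.max (a x - b x - k) 0 by rewrite le_max lexx orbT.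
have w's0 x : 0 <= Num.max (a' x - b' x) 0 by rewrite le_max lexx orbT.
have mL1 := measurable_funD mk (mZ (tau * mass nu1) _ meta).
have L10 x := addr_ge0 (ks0 x) (Z0 _ _ m10 eta0 x).
have mL := measurable_funD mL1 (mZ (tau * mass nu2) _ mpsip).
have L0 x := addr_ge0 (L10 x) (Z0 _ _ m20 psip0 x).
have mR1 := measurable_funD mw' mFG.
have R10 x := addr_ge0 (w's0 x) (FG0 x).
have mR2 := measurable_funD mR1 (mZ tau _ mj1).
have R20 x := addr_ge0 (R10 x) (Z0 _ _ t0 j10 x).
have mR3 := measurable_funD mR2 (mZ (tau * mass nu1 * d) _ mwp).
have R30 x := addr_ge0 (R20 x) (Z0 _ _ m1d0 wp0 x).
have mR := measurable_funD mR3 (mZ tau _ mj2).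
have R0 x := addr_ge0 (R30 x) (Z0 _ _ t0 j20 x).
have : (I (fun x => (Num.max (a x - b x - k) 0 + tau * mass nu1 * eta d k x +
    tau * mass nu2 * psip x)%R) <=
  I (fun x => (Num.max (a' x - b' x) 0 + tau * Num.max (F x - G x) 0 +
    tau * jump_mean nu1 (eta d k) x + tau * mass nu1 * d * wp x +
    tau * jump_mean nu2 psip x)%R))%E.
  apply: ae_ge0_le_integral => //.
  - by move=> x _; rewrite lee_fin; exact: L0.
  - exact/measurable_EFinP.
  - by move=> x _; rewrite lee_fin; exact: R0.
  - exact/measurable_EFinP.
  - by apply: filterS (step_pointwise d0 k0) => x + _; rewrite lee_fin.
rewrite integralD_EFin; [|exact: mL1|exact: mZ|exact: L10|exact: Z0].
rewrite integralD_EFin; [|exact: mk|exact: mZ|exact: ks0|exact: Z0].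
rewrite integralD_EFin; [|exact: mR3|exact: mZ|exact: R30|exact: Z0].
rewrite integralD_EFin; [|exact: mR2|exact: mZ|exact: R20|exact: Z0].
rewrite integralD_EFin; [|exact: mR1|exact: mZ|exact: R10|exact: Z0].
rewrite integralD_EFin; [|exact: mw'|exact: mFG|exact: w's0|exact: FG0].
rewrite !integralZ_EFin//.
rewrite [I (jump_mean nu1 _)]ge0_integral_jump_mean//.
rewrite [I (jump_mean nu2 _)]ge0_integral_jump_mean//.
rewrite !muleA -!EFinM -/H -/X.
have HX : (H + X)%E \is a fin_num by rewrite fin_numD Hfin Xfin.
move=> ineq; rewrite -(@leeD2rE _ _ _ _ HX) !addeA; apply: (le_trans ineq).
by rewrite [in leRHS](addeAC _ _ H).
Qed.

Lemma step_contraction :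
  (\int[mu]_x (Num.max (a x - b x) 0)%:E <=
   \int[mu]_x (Num.max (a' x - b' x) 0)%:E +
   \int[mu]_x (tau * Num.max (F x - G x) 0)%:E)%E.
Proof.
apply: integral_max0_le.
  by case: ba bb => [? _] [? _]; exact: measurable_funB.
move=> k k0; apply/lee_addgt0Pr => e e0.
have m10 : 0 <= tau * mass nu1 by rewrite mulr_ge0 ?mass_ge0// ltW.
have Iwp : I wp \is a fin_num by apply: integrable_fin_num => //; exact: iwp.
have W0 : 0 <= fine (I wp).
  by apply/fine_ge0/integral_ge0 => x _; rewrite lee_fin le_max lexx orbT.
(* With [d = e / c] the remaining term is at most [e]; the summand 1 keeps [c] positive. Thus [d]
   tends to 0 for fixed [k]. *)
pose c := tau * mass nu1 * fine (I wp) + 1.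
have c0 : 0 < c by rewrite ltr_wpDl// mulr_ge0.
have d0 : 0 < e / c by rewrite divr_gt0.
apply: (le_trans (step_integral d0 k0)); apply: leeD => //.
rewrite -(fineK Iwp) -EFinM lee_fin mulrAC mulrA ler_pdivrMr// mulrC.
by rewrite ler_wpM2l ?ltW// /c; lra.
Qed.

End step_contraction.

(** * Integration over space-time slabs *)

Section strip.
Context d1 d2 (T1 : measurableType d1) (T2 : measurableType d2) (R : realType).
Context (m1 : {sigma_finite_measure set T1 -> \bar R}).
Context (m2 : {sigma_finite_measure set T2 -> \bar R}).
Context (D : set T2) (h : T1 * T2 -> \bar R).
Hypothesis mD : measurable D.
Hypothesis mh : measurable_fun ([set: T1] `*` D) h.

(** Extension by zero makes Fubini and Tonelli on the whole product applicable to a function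
    controlled on the strip only. *)
Let hD := h \_ ([set: T1] `*` D).

Let hDE x s : hD (x, s) = ((fun s => h (x, s)) \_ D) s.
Proof.
rewrite /hD !patchE; have [sD|sD] := boolP (s \in D).
  by rewrite mem_set//; split => //; exact: set_mem.
by rewrite memNset// => -[_ /mem_set]; apply/negP.
Qed.

Let mhD : measurable_fun setT hD.
Proof.
by apply/(measurable_restrict _ (measurableX measurableT mD)) => //; rewrite setTI.
Qed.

Let integral1E x : (\int[m2]_(s in D) h (x, s) = \int[m2]_s hD (x, s))%E.
Proof. by rewrite integral_mkcond; apply: eq_integral => s _; rewrite hDE. Qed.

Let integral2E s :
  (\int[m1]_x hD (x, s) = ((fun s => \int[m1]_x h (x, s)) \_ D) s)%E.
Proof.
rewrite [RHS]patchE; case: ifPn => sD.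
  by apply: eq_integral => x _; rewrite hDE patchE sD.
by rewrite integral0_eq// => x _; rewrite hDE patchE (negbTE sD).
Qed.

Lemma measurable_strip_section s : D s -> measurable_fun setT (fun x => h (x, s)).
Proof.
move=> Ds; rewrite (_ : (fun _ => _) = (fun x => hD (x, s))); last first.
  by apply/funext => x; rewrite hDE patchE mem_set.
exact: measurable_fun_pair1.
Qed.

Section nonnegative.
Hypothesis h0 : forall p, (0 <= h p)%E.

Let hD0 p : (0 <= hD p)%E.
Proof. by rewrite /hD patchE; case: ifPn. Qed.

Lemma measurable_strip_integral1 :
  measurable_fun setT (fun x => \int[m2]_(s in D) h (x, s))%E.
Proof.
under eq_fun do rewrite integral1E.
exact: measurable_fun_fubini_tonelli_F.
Qed.

Lemma measurable_strip_integral2 :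
  measurable_fun D (fun s => \int[m1]_x h (x, s))%E.
Proof.
rewrite -(setTI D).
apply/(measurable_restrict (fun s => \int[m1]_x h (x, s))%E mD measurableT).
rewrite (_ : _ \_ _ = (fun s => \int[m1]_x hD (x, s))%E); last first.
  by apply/funext => s; rewrite integral2E.
exact: measurable_fun_fubini_tonelli_G.
Qed.

Lemma strip_tonelli :
  (\int[m1]_x \int[m2]_(s in D) h (x, s) = \int[m2]_(s in D) \int[m1]_x h (x, s))%E.
Proof.
under eq_integral do rewrite integral1E.
rewrite fubini_tonelli// [RHS]integral_mkcond.
by apply: eq_integral => s _; rewrite integral2E.
Qed.

Lemma strip_tonelli_prod :
  (\int[(m1 \x m2)%E]_(p in [set: T1] `*` D) h p =
   \int[m2]_(s in D) \int[m1]_x h (x, s))%E.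
Proof.
rewrite integral_mkcond -/hD fubini_tonelli2// /fubini_G [RHS]integral_mkcond.
by apply: eq_integral => s _; rewrite -integral2E.
Qed.

End nonnegative.

Section integrable.
Hypothesis ih : (\int[m2]_(s in D) \int[m1]_x `|h (x, s)| < +oo)%E.

Let ihD : (m1 \x m2)%E.-integrable setT hD.
Proof.
apply/(integrable21ltyP _ _ mhD).
rewrite (_ : (\int[m2]_s _ = \int[m2]_(s in D) \int[m1]_x `|h (x, s)|)%E)//.
rewrite [RHS]integral_mkcond; apply: eq_integral => s _.
rewrite [RHS]patchE; case: ifPn => sD.
  by apply: eq_integral => x _; rewrite hDE patchE sD.
by rewrite integral0_eq// => x _; rewrite hDE patchE (negbTE sD) abse0.
Qed.

Lemma strip_ae_integrable1 :
  \forall x \ae m1, m2.-integrable D (fun s => h (x, s)).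
Proof.
apply: filterS (ae_integrable1 ihD) => x ihx.
apply/integrable_mkcond => //.
by apply: eq_integrable ihx => // s _; rewrite hDE.
Qed.

Lemma strip_integrable1 :
  m1.-integrable setT (fun x => \int[m2]_(s in D) h (x, s))%E.
Proof.
under eq_fun do rewrite integral1E.
exact: integrable_fubini_F ihD.
Qed.

Lemma strip_fubini :
  (\int[m1]_x \int[m2]_(s in D) h (x, s) = \int[m2]_(s in D) \int[m1]_x h (x, s))%E.
Proof.
under eq_integral do rewrite integral1E.
rewrite (Fubini ihD) [RHS]integral_mkcond.
by apply: eq_integral => s _; rewrite integral2E.
Qed.

Lemma strip_integrable2 :
  m2.-integrable D (fun s => \int[m1]_x h (x, s))%E.
Proof.
apply/integrable_mkcond => //.
rewrite (_ : _ \_ _ = (fun s => \int[m1]_x hD (x, s))%E); last first.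
  by apply/funext => s; rewrite integral2E.
apply/integrableP; split; first exact: measurable_fubini_G ihD.
apply: le_lt_trans ((integrable21ltyP _ _ mhD).1 ihD).
apply: ge0_le_integral => //.
- by apply: measurableT_comp => //; exact: measurable_fubini_G ihD.
- apply: (measurable_fun_fubini_tonelli_G (abse \o hD)) => //=.
  exact: measurableT_comp.
- move=> s _; apply: le_abse_integral => //.
  exact: measurable_fun_pair1.
Qed.

End integrable.

Lemma measurable_strip_integral :
  measurable_fun setT (fun x => \int[m2]_(s in D) h (x, s))%E.
Proof.
under eq_fun do rewrite integral1E integralE.
apply: emeasurable_funB.
- under eq_fun do rewrite (funepos_comp hD (pair _)).
  apply: (measurable_fun_fubini_tonelli_F (hD^\+)%E) => //.
  exact: measurable_funepos.
- under eq_fun do rewrite (funeneg_comp hD (pair _)).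
  apply: (measurable_fun_fubini_tonelli_F (hD^\-)%E) => //.
  exact: measurable_funeneg.
Qed.

End strip.

(** * Spatial norms of the time slices *)

Section norms.
Context (R : realType) (N : nat).
Local Notation mu := (lebesgue_rV R N).
Local Notation leb := (@lebesgue_measure R).
Implicit Types (u : 'rV[R]_N -> R) (D : set (measurableTypeR R)).

Lemma L1_normE u : L1_norm u = (\int[mu]_x `|u x|%:E)%E.
Proof. by rewrite /L1_norm Lnorm1. Qed.

Lemma L1_norm_ge0 u : (0 <= L1_norm u)%E.
Proof. exact: Lnorm_ge0. Qed.

Lemma Linf_norm_ge0 u : (0 <= Linf_norm u)%E.
Proof. exact: Lnorm_ge0. Qed.

Lemma Linf_norm_le u (y : \bar R) :
  (Linf_norm u <= y)%E <-> \forall x \ae mu, (`|u x|%:E <= y)%E.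
Proof.
have -> : Linf_norm u = ess_sup mu (fun x => `|u x|%:E).
  by rewrite /Linf_norm unlock /= lebesgue_rV_setT_gt0.
by split=> [/ess_supP|?]; last apply/ess_supP.
Qed.

Section strip.
Context D (f : 'rV[R]_N -> R -> R).
Hypothesis mD : measurable D.
Hypothesis mf : measurable_fun ([set: 'rV[R]_N] `*` D)
  (fun p : 'rV[R]_N * measurableTypeR R => f p.1 p.2).

Let h (p : 'rV[R]_N * measurableTypeR R) := (f p.1 p.2)%:E.

Let mh : measurable_fun ([set: 'rV[R]_N] `*` D) h.
Proof. exact/measurable_EFinP. Qed.

Let ma : measurable_fun ([set: 'rV[R]_N] `*` D)
  (fun p : 'rV[R]_N * measurableTypeR R => `|f p.1 p.2|%:E).
Proof. by apply/measurable_EFinP; exact: measurableT_comp. Qed.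

Lemma measurable_time_section s : D s -> measurable_fun setT (f^~ s).
Proof. by move=> Ds; apply/measurable_EFinP; exact: (measurable_strip_section mD mh). Qed.

Lemma measurable_L1_norm :
  measurable_fun D (fun s : measurableTypeR R => L1_norm (f^~ s)).
Proof.
under eq_fun do rewrite L1_normE.
by apply: (measurable_strip_integral2 mu mD ma) => p; rewrite lee_fin.
Qed.

(** The norm at time [s] exceeds [y] exactly when the set of [x] with [|f x s| > y] has positive
    measure. That measure is the integral over [x] of an indicator, hence measurable in [s] by
    Tonelli. *)
Lemma measurable_Linf_norm :
  measurable_fun D (fun s : measurableTypeR R => Linf_norm (f^~ s)).
Proof.
move=> mD'; apply: (measurability _ (ErealGenOInfty.measurableE R)) => //.
move=> _ [_ [y ->] <-].
pose A : set R := `]y, +oo[%classic.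
pose k (p : 'rV[R]_N * measurableTypeR R) := (\1_A `|f p.1 p.2| : R)%:E.
have mk : measurable_fun ([set: 'rV[R]_N] `*` D) k.
  have mA : measurable_fun setT (\1_A : R -> R).
    by apply: measurable_indic; exact: measurable_itv.
  apply/measurable_EFinP; apply: (measurableT_comp mA).
  exact: measurableT_comp.
have k0 p : (0 <= k p)%E by rewrite lee_fin.
have mI := measurable_strip_integral2 mu mD mk k0.
rewrite (_ : _ `&` _ = D `&` (fun s => \int[mu]_x k (x, s))%E @^-1` [set~ 0%E]).
  by apply: mI => //; apply: measurableC; exact: emeasurable_set1.
have kE s : D s -> (\int[mu]_x k (x, s) = 0)%E <-> (Linf_norm (f^~ s) <= y%:E)%E.
  move=> Ds; have ms : measurable_fun setT (fun x => `|f x s|%:E).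
    apply/measurable_EFinP; apply: measurableT_comp => //.
    exact: measurable_time_section.
  apply: (iff_trans _ (iff_sym (Linf_norm_le _ _))).
  apply: (iff_trans _ (iff_sym (ae_le_measureP _ _ ms))).
  rewrite (_ : (\int[mu]_x _)%E = mu ((fun x => `|f x s|%:E) @^-1` `]y%:E, +oo[))//.
  rewrite -[X in _ = mu X]setIT -integral_indic//; last first.
    by rewrite -[X in measurable X]setTI; apply: ms => //; exact: emeasurable_itv.
apply/seteqP; split=> s [Ds] /= H; split=> //.
  rewrite in_itv/= andbT ltNge in H.
  by move=> /(kE _ Ds) /=; apply/negP.
by rewrite in_itv/= andbT ltNge; apply/negP => /(kE _ Ds).
Qed.

End strip.
End norms.

Section slab.
Context (R : realType) (N : nat).
Local Notation mu := (lebesgue_rV R N).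
Local Notation leb := (@lebesgue_measure R).
Context (D : set (measurableTypeR R)).
Hypothesis mD : measurable D.
Implicit Types (f g : 'rV[R]_N -> R -> R).

Local Notation strip_mfun f := (measurable_fun ([set: 'rV[R]_N] `*` D)
  (fun p : 'rV[R]_N * measurableTypeR R => f p.1 p.2)).

Lemma measurable_slab f : strip_mfun f ->
  measurable_fun setT (fun x => \int[leb]_(s in D) f x s).
Proof.
move=> mf; apply: (measurableT_comp (f := fine)); first exact: fine_measurable.
apply: (measurable_strip_integral leb mD (h := fun p => (f p.1 p.2)%:E)).
exact/measurable_EFinP.
Qed.

(** For almost every [x] the positive part of a time integral is at most the integral of the
    positive part; Tonelli then exchanges space and time. *)
Lemma slab_comparison f g : strip_mfun f -> strip_mfun g ->
  (\forall x \ae mu, leb.-integrable D (EFin \o f x)) ->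
  (\forall x \ae mu, leb.-integrable D (EFin \o g x)) ->
  (\int[mu]_x
     (Num.max (\int[leb]_(s in D) f x s - \int[leb]_(s in D) g x s)%R 0%R)%:E <=
   \int[leb]_(s in D) \int[mu]_x (Num.max (f x s - g x s)%R 0%R)%:E)%E.
Proof.
move=> mf mg fI gI.
pose h (p : 'rV[R]_N * measurableTypeR R) := (Num.max (f p.1 p.2 - g p.1 p.2) 0)%:E.
have mh : measurable_fun ([set: 'rV[R]_N] `*` D) h.
  by apply/measurable_EFinP; apply: measurable_maxr => //; exact: measurable_funB.
have h0 p : (0 <= h p)%E by rewrite lee_fin le_max lexx orbT.
rewrite -(strip_tonelli mu leb mD mh h0).
apply: ae_ge0_le_integral => //.
- by move=> x _; rewrite lee_fin le_max lexx orbT.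
- apply/measurable_EFinP; apply: measurable_maxr => //.
  by apply: measurable_funB; exact: measurable_slab.
- by move=> x _; apply: integral_ge0.
- exact: (measurable_strip_integral1 leb mD mh h0).
apply: filterS2 fI gI => x fxI gxI _.
have hxI : leb.-integrable D (fun s => h (x, s)).
  have := integrable_funepos mD (integrableB mD fxI gxI).
  apply: eq_integrable => // s _.
  by rewrite funeposE /h /= -EFinB EFin_max.
rewrite -[leRHS]fineK; last exact: integrable_fin_num.
rewrite lee_fin -RintegralB// ge_max; apply/andP; split; last first.
  by apply/fine_ge0/integral_ge0.
apply: le_Rintegral => //; first exact: (integrableB mD fxI gxI).
by move=> s _; rewrite le_max lexx.
Qed.

End slab.

(** * Lipschitz bounds, the time grid and the CFL condition *)

Lemma lipschitz_at (R : realType) (phi : R -> R) (a : R) : locally_lipschitz phi ->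
  exists r k, [/\ 0 < r, 0 <= k &
    forall s, `|s - a| < r -> `|phi s - phi a| <= k * `|s - a|].
Proof.
(* Near the diagonal point [(a, a)] every constant above some [k0] is a Lipschitz constant;
   [Num.max k0 0 + 1] is one that is also nonnegative. It is then applied to the pairs [(s, a)]. *)
move=> /(_ (a, a) (conj I I)) [k0 [_ /(_ (Num.max k0 0 + 1))]].
have -> : k0 < Num.max k0 0 + 1 by rewrite ltr_pwDr// le_max lexx.
move=> /(_ isT) /=.
rewrite /dominated_by /= => -[[A B] /= [nA nB] AB].
case: nA => r /= r0 rA.
exists r, (Num.max k0 0 + 1); split=> //.
  by rewrite addr_ge0// le_max lexx orbT.
move=> s sr; apply: (AB (s, a)) => /=; last by [].
split; first by apply: rA; rewrite /= distrC.
exact: nbhs_singleton.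
Qed.

(** Near 0 the local Lipschitz constant serves; at distance at least [r] the oscillation of [phi],
    controlled by monotonicity, is divided by [r]. The bound serves to make [phi \o u - phi 0]
    integrable. *)
Lemma homo_lipschitz_bound (R : realType) (phi : R -> R) (K : R) :
  {homo phi : r s / r <= s} -> locally_lipschitz phi ->
  exists C, forall s, `|s| <= K -> `|phi s - phi 0| <= C * `|s|.
Proof.
move=> hphi /(lipschitz_at 0)[r [k [r0 k0 rphi]]].
pose C := Num.max k ((phi `|K| - phi (- `|K|)) / r).
exists C => s sK; have [sr|rs] := ltP `|s| r.
  have := rphi s; rewrite subr0 => /(_ sr) /le_trans; apply.
  by rewrite ler_wpM2r// le_max lexx.
apply: (@le_trans _ _ (phi `|K| - phi (- `|K|))).
  have sK' : `|s| <= `|K| by rewrite (le_trans sK)// ler_norm.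
  have /andP[? ?] : - `|K| <= s <= `|K| by rewrite -ler_norml.
  have : phi (- `|K|) <= phi s <= phi `|K| by rewrite !hphi.
  have : phi (- `|K|) <= phi 0 <= phi `|K| by rewrite !hphi// oppr_le0.
  by rewrite ler_norml => /andP[? ?] /andP[? ?]; apply/andP; split; lra.
apply: (@le_trans _ _ ((phi `|K| - phi (- `|K|)) / r * `|s|)).
  rewrite mulrAC ler_pdivlMr// ler_wpM2l// subr_ge0 hphi//.
  by rewrite (@le_trans _ _ 0)// oppr_le0.
by rewrite ler_wpM2r// le_max lexx orbT.
Qed.

(** Each Lipschitz constant bounds the difference quotient, hence so does their infimum. For [r = s]
    the right-hand side is 0 even if the infimum is [+oo]. *)
Lemma lipschitz_const_ge (R : realType) (phi : R -> R) (A : set R) (r s : R) :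
  A r -> A s -> (`|phi r - phi s|%:E <= lipschitz_const phi A * `|r - s|%:E)%E.
Proof.
move=> Ar As; have [->|rs] := eqVneq r s.
  by rewrite !subrr normr0 mule0.
have rs0 : 0 < `|r - s| by rewrite normr_gt0 subr_eq0.
rewrite -lee_pdivrMr//; apply: le_ereal_inf_tmp => _ [k [k0 kphi] <-].
rewrite -EFinM lee_fin ler_pdivrMr//.
exact: (kphi (r, s)).
Qed.

Section grid.
Context (R : realType) (T : R) (J : nat) (t : nat -> R).
Hypothesis gt : time_grid T J t.

Lemma grid_lt j : (1 <= j <= J)%N -> t j.-1 < t j.
Proof. by case: gt => _ _ tS /andP[]; case: j => // j _ jJ; exact: tS. Qed.

Lemma grid_le j k : (j <= k <= J)%N -> t j <= t k.
Proof.
case: gt => _ _ tS /andP[/subnKC <-].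
elim: (k - j)%N => [|n IH]; first by rewrite addn0.
by rewrite addnS => jnJ; rewrite (le_trans (IH (ltnW jnJ)))// ltW// tS.
Qed.

Lemma grid_ge0 j : (j <= J)%N -> 0 <= t j.
Proof. by move=> jJ; case: gt => <- _ _; rewrite grid_le. Qed.

Lemma grid_leT j : (j <= J)%N -> t j <= T.
Proof. by move=> jJ; case: gt => _ <- _; rewrite grid_le// jJ/=. Qed.

Lemma time_step_gt0 j : (1 <= j <= J)%N -> 0 < time_step t j.
Proof. by move=> /grid_lt; rewrite subr_gt0. Qed.

Lemma time_step_le_max j : (1 <= j <= J)%N -> time_step t j <= max_time_step J t.
Proof.
move=> /andP[j1 jJ]; rewrite /max_time_step.
by apply: (@le_bigmax_seq _ _ _ _ _ _ _ (time_step t)); rewrite ?mem_index_iota ?j1.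
Qed.

(** The form in which the contraction uses the CFL condition. The chain of inequalities stays in the
    extended reals because the Lipschitz constant might a priori be infinite. *)
Lemma cfl_pointwise (N : nat) (nu : {finite_measure set 'rV[R]_N -> \bar R})
    (phi : R -> R) (M : R) j (r s : R) : (1 <= j <= J)%N ->
  ((max_time_step J t)%:E * lipschitz_const phi `[(- M)%R, M]%classic * nu setT <= 1)%E ->
  `|r| <= M -> `|s| <= M ->
  time_step t j * fine (nu setT) * `|phi r - phi s| <= `|r - s|.
Proof.
move=> jJ cfl rM sM.
have dt0 := time_step_gt0 jJ; have dtmax := time_step_le_max jJ.
have /(_ r s) := @lipschitz_const_ge _ phi `[- M, M].
rewrite /= !in_itv/= -!ler_norml => /(_ rM sM) lip.
have nu0 := mass_ge0 nu.
rewrite -lee_fin EFinM (EFinM (time_step t j)) EFin_mass.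
apply: (@le_trans _ _ ((max_time_step J t)%:E * nu setT * `|phi r - phi s|%:E)%E).
  by rewrite lee_wpmul2r// lee_wpmul2r// lee_fin.
apply: (@le_trans _ _ ((max_time_step J t)%:E * nu setT *
    (lipschitz_const phi `[(- M)%R, M]%classic * `|r - s|%:E))%E).
  rewrite lee_wpmul2l// mule_ge0// lee_fin.
  by rewrite (le_trans (ltW dt0)).
rewrite muleA (muleAC _ (nu _)) -[leRHS]mul1e.
by rewrite lee_wpmul2r.
Qed.

End grid.

(** * Real-valued integrals and integrability of the source terms *)

Section fine_integral.
Context d (X : measurableType d) (R : realType).
Context (m : {measure set X -> \bar R}) (D : set X) (phi : X -> \bar R).
Hypothesis mD : measurable D.
Hypothesis iphi : m.-integrable D phi.

Lemma integrable_fine : m.-integrable D (EFin \o (fine \o phi)).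
Proof.
have mphi := measurable_int m iphi.
apply: (le_integrable mD _ _ iphi).
  by apply/measurable_EFinP; apply: measurableT_comp => //; exact: fine_measurable.
by move=> x Dx /=; case: (phi x) => [r| |] //=; rewrite normr0 leey.
Qed.

(** An integrable function is finite almost everywhere, so [fine] takes its default value on a null
    set only. *)
Lemma integral_fine : (\int[m]_(x in D) (fine (phi x))%:E = \int[m]_(x in D) phi x)%E.
Proof.
have mphi := measurable_int m iphi.
apply: ae_eq_integral => //; first exact: measurable_int integrable_fine.
by apply: filterS (integrable_ae mD iphi) => x /[apply] ?; rewrite fineK.
Qed.

Lemma Rintegral_fine :
  \int[m]_(x in D) fine (phi x) = fine (\int[m]_(x in D) phi x)%E.
Proof. by rewrite /Rintegral integral_fine. Qed.

End fine_integral.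

Lemma ge0_integral_itv_cat (R : realType) (a b c : R)
    (phi : measurableTypeR R -> \bar R) : a <= b -> b <= c ->
  measurable_fun `]a, c[ phi -> (forall s, 0 <= phi s)%E ->
  (\int[@lebesgue_measure R]_(s in `]a, c[) phi s =
   \int[@lebesgue_measure R]_(s in `]a, b[) phi s +
   \int[@lebesgue_measure R]_(s in `]b, c[) phi s)%E.
Proof.
move=> ab; rewrite le_eqVlt => /predU1P[<-|bc] mphi phi0.
  by rewrite set_itvoo0 integral_set0 adde0.
have S : `]a, c[%classic = `]a, b] `|` `]b, c[ :> set R.
  by rewrite (@itv_bndbnd_setU _ _ _ (BRight b)) ?bnd_simp.
rewrite S ge0_integral_setU//=; last 2 first.
- by rewrite -S.
- apply/disj_setPS => s [/=]; rewrite !in_itv/= => /andP[_ sb] /andP[].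
  by rewrite ltNge sb.
congr (_ + _)%E; rewrite -integral_itv_bndo_bndc//.
apply: measurable_funS mphi => //.
by move=> s /=; rewrite !in_itv/= => /andP[-> /lt_trans]; apply.
Qed.

Section source.
Context (R : realType) (N : nat).
Local Notation mu := (lebesgue_rV R N).
Local Notation leb := (@lebesgue_measure R).
Context (T : R) (f : 'rV[R]_N -> R -> R).
Hypothesis sf : source_term T f.

Lemma source_strip (D : set (measurableTypeR R)) : measurable D ->
  D `<=` `]0, T[ ->
  measurable_fun ([set: 'rV[R]_N] `*` D)
    (fun p : 'rV[R]_N * measurableTypeR R => f p.1 p.2).
Proof.
move=> mD DT; apply: measurable_funS (sf.1); first exact: measurableX.
by move=> p [_ /DT].
Qed.

Let mT : measurable (`]0, T[%classic : set (measurableTypeR R)).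
Proof. exact: measurable_itv. Qed.

Let mI := source_strip mT (@subset_refl _ _).

Lemma source_L1_lty :
  (\int[leb]_(s in `]0%R, T[) L1_norm (f^~ s) < +oo)%E.
Proof.
apply: le_lt_trans sf.2; apply: ge0_le_integral => //.
- by move=> s _; exact: L1_norm_ge0.
- exact: measurable_L1_norm.
- by apply: emeasurable_funD; [exact: measurable_L1_norm|exact: measurable_Linf_norm].
- by move=> s _; rewrite leeDl// Linf_norm_ge0.
Qed.

Lemma source_Linf_integrable :
  leb.-integrable `]0, T[ (fun s => Linf_norm (f^~ s)).
Proof.
apply/integrableP; split; first exact: measurable_Linf_norm.
under eq_integral do rewrite gee0_abs ?Linf_norm_ge0//.
apply: le_lt_trans sf.2; apply: ge0_le_integral => //.
- by move=> s _; exact: Linf_norm_ge0.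
- exact: measurable_Linf_norm.
- by apply: emeasurable_funD; [exact: measurable_L1_norm|exact: measurable_Linf_norm].
- by move=> s _; rewrite leeDr// L1_norm_ge0.
Qed.

Section slab.
Context (D : set (measurableTypeR R)).
Hypotheses (mD : measurable D) (DT : D `<=` `]0, T[).

Let h (p : 'rV[R]_N * measurableTypeR R) := (f p.1 p.2)%:E.

Let mh : measurable_fun ([set: 'rV[R]_N] `*` D) h.
Proof. by apply/measurable_EFinP; exact: source_strip. Qed.

Let ih : (\int[leb]_(s in D) \int[mu]_x `|h (x, s)| < +oo)%E.
Proof.
apply: le_lt_trans source_L1_lty.
have -> : (\int[leb]_(s in D) \int[mu]_x `|h (x, s)| =
           \int[leb]_(s in D) L1_norm (f^~ s))%E.
  by apply: eq_integral => s _; rewrite L1_normE.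
apply: ge0_subset_integral => //; first exact: measurable_L1_norm.
by move=> s _; exact: L1_norm_ge0.
Qed.

Lemma source_ae_integrable : \forall x \ae mu, leb.-integrable D (EFin \o f x).
Proof. exact: (strip_ae_integrable1 (m1 := mu) mD mh ih). Qed.

Lemma source_space_integrable :
  mu.-integrable setT (fun x => (\int[leb]_(s in D) f x s)%:E).
Proof. exact: (integrable_fine measurableT (strip_integrable1 (m1 := mu) mD mh ih)). Qed.

Lemma source_time_integrable :
  leb.-integrable D (fun s => (\int[mu]_x f x s)%:E).
Proof. exact: (integrable_fine mD (strip_integrable2 (m1 := mu) mD mh ih)). Qed.

Lemma source_fubini :
  \int[mu]_x (\int[leb]_(s in D) f x s) = \int[leb]_(s in D) (\int[mu]_x f x s).
Proof.
rewrite (Rintegral_fine measurableT (strip_integrable1 (m1 := mu) mD mh ih)).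
rewrite (Rintegral_fine mD (strip_integrable2 (m1 := mu) mD mh ih)).
by rewrite (strip_fubini (m1 := mu) mD mh ih).
Qed.

End slab.
End source.

(** * Stability of the scheme *)

Section scheme.
Context (R : realType) (N : nat).
Local Notation mu := (lebesgue_rV R N).
Local Notation leb := (@lebesgue_measure R).
Local Notation mass nu := (fine (nu [set: 'rV[R]_N])).
Implicit Types (u v : 'rV[R]_N -> R) (f g : 'rV[R]_N -> R -> R).

Lemma L1_Linf_measurable u : L1_Linf u -> measurable_fun setT u.
Proof. by case=> /sub_Lfun_mfun; rewrite inE. Qed.

Lemma L1_Linf_integrable u : L1_Linf u -> mu.-integrable setT (EFin \o u).
Proof. by case=> /Lfun1_integrable. Qed.

Lemma L1_Linf_lty u : L1_Linf u -> (Linf_norm u < +oo)%E.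
Proof. by case=> _ /sub_Lfun_finLfun; rewrite inE. Qed.

Lemma L1_Linf_ae_bound u : L1_Linf u ->
  \forall x \ae mu, `|u x| <= fine (Linf_norm u).
Proof.
move=> Lu; have /Linf_norm_le := lexx (Linf_norm u).
apply: filterS => x; rewrite -lee_fin fineK//.
by rewrite ge0_fin_numE ?L1_Linf_lty// Linf_norm_ge0.
Qed.

(* Since nu may be singular, an a.e. bound on u says nothing about
   z |-> u (x + z) at a given x, hence the need for a bound at every point. *)
Definition clip u (x : 'rV[R]_N) : R :=
  if `|u x| <= fine (Linf_norm u) then u x else 0.

Lemma clip_ae u : L1_Linf u -> \forall x \ae mu, clip u x = u x.
Proof. by move/L1_Linf_ae_bound; apply: filterS => x; rewrite /clip => ->. Qed.

Lemma bounded_mfun_clip u : L1_Linf u -> bounded_mfun (clip u).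
Proof.
move=> /L1_Linf_measurable mu'; split.
  apply: measurable_fun_ifT => //; apply: measurable_fun_ler => //.
  exact: measurableT_comp.
exists (fine (Linf_norm u)) => x; rewrite /clip; case: ifPn => // _.
by rewrite normr0 fine_ge0// Linf_norm_ge0.
Qed.

Lemma integrable_clip u : L1_Linf u -> mu.-integrable setT (EFin \o clip u).
Proof.
move=> Lu; apply: (le_integrable _ _ _ (L1_Linf_integrable Lu)) => //.
  by have [? _] := bounded_mfun_clip Lu; exact/measurable_EFinP.
by move=> x _; rewrite /= lee_fin /clip; case: ifPn => // _; rewrite normr0.
Qed.

Lemma integrable_max0 u : mu.-integrable setT (EFin \o u) ->
  mu.-integrable setT (fun x => (Num.max (u x) 0)%:E).
Proof.
move=> iu; have := integrable_funepos measurableT iu.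
by apply: eq_integrable => // x _; rewrite funeposE /= EFin_max.
Qed.

Lemma integrable_maxN0 u : mu.-integrable setT (EFin \o u) ->
  mu.-integrable setT (fun x => (Num.max (- u x) 0)%:E).
Proof.
move=> iu; apply: (integrable_max0 (u := fun x => - u x)).
by have := integrableN iu; exact: eq_integrable.
Qed.

Context (t : nat -> R) (nu1 nu2 : {finite_measure set 'rV[R]_N -> \bar R}).
Context (phi1 phi2 : R -> R).
Hypothesis hphi1 : {homo phi1 : r s / r <= s}.
Hypothesis hphi2 : {homo phi2 : r s / r <= s}.

Definition scheme_step f (j : nat) (W : nat -> 'rV[R]_N -> R) :=
  \forall x \ae mu, W j x = W j.-1 x + time_step t j *
    (jump_op nu1 (phi1 \o W j) x + jump_op nu2 (phi2 \o W j.-1) x +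
     source_mean t f j x).

(** Clipping alters each function on a null set only, and by [ae_eq_jump_op] this alters the jump
    operators on a null set only. *)
Lemma scheme_step_clip f j (U : nat -> 'rV[R]_N -> R) :
  L1_Linf (U j) -> L1_Linf (U j.-1) ->
  scheme_step f j U -> scheme_step f j (fun i => clip (U i)).
Proof.
move=> Lj Lj' stepU.
have mphi1 : measurable_fun setT phi1 by exact: nondecreasing_measurable.
have mphi2 : measurable_fun setT phi2 by exact: nondecreasing_measurable.
have J1 : \forall x \ae mu, jump_op nu1 (phi1 \o clip (U j)) x =
    jump_op nu1 (phi1 \o U j) x.
  apply: ae_eq_jump_op.
  - by apply: measurableT_comp => //; have [] := bounded_mfun_clip Lj.
  - by apply: measurableT_comp => //; exact: L1_Linf_measurable.
  - by apply: filterS (clip_ae Lj) => x /= ->.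
have J2 : \forall x \ae mu, jump_op nu2 (phi2 \o clip (U j.-1)) x =
    jump_op nu2 (phi2 \o U j.-1) x.
  apply: ae_eq_jump_op.
  - by apply: measurableT_comp => //; have [] := bounded_mfun_clip Lj'.
  - by apply: measurableT_comp => //; exact: L1_Linf_measurable.
  - by apply: filterS (clip_ae Lj') => x /= ->.
have E : \forall x \ae mu, clip (U j) x = U j x /\ clip (U j.-1) x = U j.-1 x.
  by apply: filterS2 (clip_ae Lj) (clip_ae Lj') => x.
have J12 : \forall x \ae mu,
    jump_op nu1 (phi1 \o clip (U j)) x = jump_op nu1 (phi1 \o U j) x /\
    jump_op nu2 (phi2 \o clip (U j.-1)) x = jump_op nu2 (phi2 \o U j.-1) x.
  by apply: filterS2 J1 J2 => x.
rewrite /scheme_step /= in stepU *.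
by apply: filterS3 stepU E J12 => x + [-> ->] [-> ->].
Qed.

Context (T : R) (J : nat) (M : R).
Hypothesis grid : time_grid T J t.
Hypothesis cphi1 : {for 0, continuous phi1}.
Hypothesis cfl : forall j r s, (1 <= j <= J)%N -> `|r| <= M -> `|s| <= M ->
  time_step t j * mass nu2 * `|phi2 r - phi2 s| <= `|r - s|.

Local Notation slab j := (`](t j.-1), (t j)[%classic : set (measurableTypeR R)).
Local Notation strip_mfun D f := (measurable_fun ([set: 'rV[R]_N] `*` D)
  (fun p : 'rV[R]_N * measurableTypeR R => f p.1 p.2)).

Lemma slab_sub j : (1 <= j <= J)%N -> slab j `<=` `]0, T[.
Proof.
move=> /andP[j1 jJ] s /=; rewrite !in_itv/= => /andP[js sj].
rewrite (le_lt_trans _ js) ?(grid_ge0 grid)// ?(leq_trans (leq_pred _))//.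
by rewrite (lt_le_trans sj)// (grid_leT grid).
Qed.

(** Combines [step_contraction] with [slab_comparison]. The bounds by [M] are asked at the previous
    level only, where the explicit part is evaluated. *)
Lemma slab_step f g (A B : nat -> 'rV[R]_N -> R) (j : nat) : (1 <= j <= J)%N ->
  strip_mfun (slab j) f -> strip_mfun (slab j) g ->
  (\forall x \ae mu, leb.-integrable (slab j) (EFin \o f x)) ->
  (\forall x \ae mu, leb.-integrable (slab j) (EFin \o g x)) ->
  (forall i, (i <= J)%N ->
    [/\ bounded_mfun (A i), bounded_mfun (B i),
      mu.-integrable setT (fun x => (Num.max (A i x) 0)%:E) &
      mu.-integrable setT (fun x => (Num.max (- B i x) 0)%:E)]) ->
  (\forall x \ae mu, `|A j.-1 x| <= M) -> (\forall x \ae mu, `|B j.-1 x| <= M) ->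
  scheme_step f j A -> scheme_step g j B ->
  (\int[mu]_x (Num.max (A j x - B j x) 0)%:E <=
   \int[mu]_x (Num.max (A j.-1 x - B j.-1 x) 0)%:E +
   \int[leb]_(s in slab j) \int[mu]_x (Num.max (f x s - g x s) 0)%:E)%E.
Proof.
move=> jJ mf mg fI gI AB AM BM stepA stepB.
have ms : measurable (slab j) by exact: measurable_itv.
have /andP[_ jJ1] := jJ.
have [bA bB iA iB] := AB j jJ1.
have [bA' bB' iA' iB'] := AB j.-1 (leq_trans (leq_pred j) jJ1).
have dt0 := time_step_gt0 grid jJ.
have msm h : strip_mfun (slab j) h -> measurable_fun setT (source_mean t h j).
  by move=> mh; apply: measurable_funM => //; exact: measurable_slab.
apply: (le_trans (step_contraction dt0 hphi1 cphi1 hphi2 bA bB bA' bB'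
  (msm _ mf) (msm _ mg) iA iB iA' iB' _ stepA stepB)).
  by apply: filterS2 AM BM => x; exact: cfl.
rewrite leeD2l//; apply: le_trans (slab_comparison ms mf mg fI gI).
(* These two integrals are equal: the positive factor [time_step t j] passes inside the maximum and
   cancels the normalisation of [source_mean]. *)
rewrite le_eqVlt; apply/orP; left; apply/eqP; apply: eq_integral => x _.
congr EFin; rewrite /source_mean -mulrBr.
rewrite -[X in X * Num.max _ _](ger0_norm (ltW dt0)).
rewrite [LHS](_ : _ = Num.max (time_step t j * ((time_step t j)^-1 *
  (\int[leb]_(s in slab j) f x s - \int[leb]_(s in slab j) g x s))) 0); last first.
  by rewrite ger0_norm ?(ltW dt0)// maxr_pMr ?(ltW dt0)// mulr0.
by rewrite mulrA divff ?mul1r// gt_eqF.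
Qed.

End scheme.

(** * Positive parts, and vanishing integrals of jump operators *)

Section positive_parts.
Context d (X : measurableType d) (R : realType) (m : {measure set X -> \bar R}).
Implicit Types u : X -> R.

Lemma integral_max0_eq0P u : measurable_fun setT u ->
  (\int[m]_x (Num.max (u x) 0)%:E <= 0)%E <-> \forall x \ae m, u x <= 0.
Proof.
move=> mu'; have m0 : measurable_fun setT (fun x => (Num.max (u x) 0)%:E).
  by apply/measurable_EFinP; exact: measurable_maxr.
have u0 x : (0 <= (Num.max (u x) 0)%:E)%E by rewrite lee_fin le_max lexx orbT.
split=> [I0|ule].
  have : (\int[m]_x `|(Num.max (u x) 0)%:E| = 0)%E.
    under eq_integral do rewrite gee0_abs//.
    by apply/eqP; rewrite eq_le I0 integral_ge0.
  move/(ae_eq_integral_abs m measurableT m0); apply: filterS => x /(_ I) [ux].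
  by rewrite -ux le_max lexx.
rewrite (ae_eq_integral (cst 0%E))//; first by rewrite integral0.
by apply: filterS ule => x ux _; rewrite max_r.
Qed.

(** The two parts are written with [u - 0] and [0 - u] to match the comparison of a solution with
    the zero solution from either side. *)
Lemma integral_normE u : measurable_fun setT u ->
  (\int[m]_x `|u x|%:E = \int[m]_x (Num.max (u x - 0)%R 0%R)%:E +
   \int[m]_x (Num.max (0 - u x)%R 0%R)%:E)%E.
Proof.
move=> mu'; rewrite -ge0_integralD//.
- apply: eq_integral => x _; rewrite -EFinD; congr EFin.
  rewrite subr0 sub0r; have [ux|ux] := leP (u x) 0.
    by rewrite ler0_norm// max_l ?oppr_ge0// add0r.
  by rewrite gtr0_norm// max_r ?addr0// oppr_le0 ltW.
- by move=> x _; rewrite lee_fin le_max lexx orbT.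
- by apply/measurable_EFinP; apply: measurable_maxr => //; exact: measurable_funB.
- by move=> x _; rewrite lee_fin le_max lexx orbT.
- by apply/measurable_EFinP; apply: measurable_maxr => //; exact: measurable_funB.
Qed.

End positive_parts.

Lemma Rintegral_itv_cat (R : realType) (a b c : R) (phi : R -> R) :
  a <= b -> b < c ->
  (@lebesgue_measure R).-integrable `]a, c[ (EFin \o phi) ->
  \int[@lebesgue_measure R]_(s in `]a, c[) phi s =
  \int[@lebesgue_measure R]_(s in `]a, b[) phi s +
  \int[@lebesgue_measure R]_(s in `]b, c[) phi s.
Proof.
move=> ab bc iphi; rewrite -(Rintegral_itvB (x := b) iphi) ?bnd_simp//.
rewrite -(@Rintegral_itv_bndo_bndc _ (BRight a) b); first by rewrite addrC subrK.
apply: integrableS iphi => //.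
by move=> s /=; rewrite !in_itv/= => /andP[-> /lt_trans]; apply.
Qed.

Section jump_op_extra.
Context (R : realType) (N : nat).
Local Notation mu := (lebesgue_rV R N).

Lemma jump_opBr (nu : {finite_measure set 'rV[R]_N -> \bar R})
    (u : 'rV[R]_N -> R) (c : R) (x : 'rV[R]_N) :
  jump_op nu (fun y => u y - c) x = jump_op nu u x.
Proof. by apply: eq_Rintegral => z _; rewrite opprB addrA subrK. Qed.

(** When [phi 0] is nonzero, [phi \o u] need not be integrable. Jump operators ignore constants, so
    it is replaced by [phi \o u - phi 0], which is dominated by a multiple of [|u|]. *)
Lemma jump_op_homo_integrable (nu : {finite_measure set 'rV[R]_N -> \bar R})
    (phi : R -> R) (u : 'rV[R]_N -> R) :
  {homo phi : r s / r <= s} -> locally_lipschitz phi -> bounded_mfun u ->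
  mu.-integrable setT (EFin \o u) ->
  mu.-integrable setT (EFin \o jump_op nu (phi \o u)) /\
  (\int[mu]_x (jump_op nu (phi \o u) x)%:E = 0)%E.
Proof.
move=> hphi lphi bu iu; have [_ [K uK]] := bu.
have [C phiC] := homo_lipschitz_bound K hphi lphi.
have E : jump_op nu (phi \o u) = jump_op nu (fun x => phi (u x) - phi 0).
  by apply/funext => x; rewrite (jump_opBr nu (phi \o u)).
rewrite E; have b0 : bounded_mfun (fun x => phi (u x) - phi 0).
  apply: bounded_mfunB; last exact: bounded_mfun_cst.
  exact: bounded_mfun_homo.
apply: integrable_jump_op => //.
apply: (le_integrable _ _ (g := fun x => (C * `|u x|)%:E)) => //.
- by case: b0 => ? _; exact/measurable_EFinP.
- move=> x _ /=; rewrite lee_fin (le_trans (phiC _ (uK x)))//.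
  exact: ler_norm.
- by apply: (integrableZr_EFin C (u := fun x => `|u x|)); exact: integrable_norm.
Qed.

End jump_op_extra.

(** * Estimates along the time grid *)

Section stability.
Context (R : realType) (N : nat).
Local Notation mu := (lebesgue_rV R N).
Local Notation leb := (@lebesgue_measure R).
Local Notation mass nu := (fine (nu [set: 'rV[R]_N])).
Local Notation Linf_at f := (fun s => Linf_norm (f^~ s)).
Context (T : R) (J : nat) (t : nat -> R) (M : R).
Context (nu1 nu2 : {finite_measure set 'rV[R]_N -> \bar R}).
Context (phi1 phi2 : R -> R).
Local Notation slab j := (`](t j.-1), (t j)[%classic : set (measurableTypeR R)).
Local Notation strip_mfun D f := (measurable_fun ([set: 'rV[R]_N] `*` D)
  (fun p : 'rV[R]_N * measurableTypeR R => f p.1 p.2)).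
Local Notation step := (scheme_step t nu1 nu2 phi1 phi2).

Hypothesis grid : time_grid T J t.
Hypothesis hphi1 : {homo phi1 : r s / r <= s}.
Hypothesis cphi1 : {for 0, continuous phi1}.
Hypothesis hphi2 : {homo phi2 : r s / r <= s}.
Hypothesis cfl : forall j r s, (1 <= j <= J)%N -> `|r| <= M -> `|s| <= M ->
  time_step t j * mass nu2 * `|phi2 r - phi2 s| <= `|r - s|.

Let mslab j : measurable (slab j).
Proof. exact: measurable_itv. Qed.

(** Jump operators annihilate constants, so a function of time alone solves the scheme once its
    increments are the integrals of the source. This supplies the comparison functions: zero and the
    barriers. *)
Lemma scheme_step_cst (n : R -> R) (c : nat -> R) (j : nat) : (1 <= j <= J)%N ->
  c j = c j.-1 + \int[leb]_(s in slab j) n s ->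
  step (fun _ s => n s) j (fun i _ => c i).
Proof.
move=> jJ cE; apply: nearW => x.
rewrite /comp !jump_op_cst !add0r /source_mean cE mulrA divff ?mul1r//.
by rewrite gt_eqF// (time_step_gt0 grid).
Qed.

(** * The L-infinity bound *)

Section one_solution.
Context (u0 : 'rV[R]_N -> R) (f : 'rV[R]_N -> R -> R) (U : nat -> 'rV[R]_N -> R).
Hypothesis Lu0 : L1_Linf u0.
Hypothesis sf : source_term T f.
Hypothesis solU : scheme_solution J t nu1 nu2 phi1 phi2 u0 f U.
Hypothesis supM : (sup_bound T u0 f <= M%:E)%E.

Let W j := clip (U j).
Let n s := fine (Linf_norm (f^~ s)).
(** The right-hand side of the L-infinity bound as a real number; as a function constant in space it
    solves the scheme with source [n]. *)
Let c j := fine (Linf_norm u0) + \int[leb]_(s in `]0, (t j)[) n s.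

Let LU j : (j <= J)%N -> L1_Linf (U j).
Proof. by case: solU => LU _ _; exact: LU. Qed.

Lemma solution_bounded j : (j <= J)%N -> bounded_mfun (W j).
Proof. by move=> /LU; exact: bounded_mfun_clip. Qed.

Lemma solution_integrable j : (j <= J)%N -> mu.-integrable setT (EFin \o W j).
Proof. by move=> /LU; exact: integrable_clip. Qed.

Lemma solution_step j : (1 <= j <= J)%N -> step f j W.
Proof.
case: solU => _ _ stepU jJ; have /andP[_ jJ1] := jJ.
apply: scheme_step_clip => //; [exact: LU| |exact: stepU].
exact/LU/(leq_trans (leq_pred _)).
Qed.

Lemma solution_ae j : (j <= J)%N -> \forall x \ae mu, W j x = U j x.
Proof. by move=> /LU; exact: clip_ae. Qed.

Lemma solution0_ae : \forall x \ae mu, W 0%N x = u0 x.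
Proof.
case: solU => _ U0 _.
by apply: filterS2 (solution_ae (leq0n J)) U0 => x -> ->.
Qed.

Let T_sub j : (j <= J)%N -> `]0, (t j)[%classic `<=` `]0, T[.
Proof.
move=> jJ s /=; rewrite !in_itv/= => /andP[-> st]/=.
exact: lt_le_trans (grid_leT grid jJ).
Qed.

Let in_ j : (j <= J)%N -> leb.-integrable `]0, (t j)[ (EFin \o n).
Proof.
move=> jJ; have iL : leb.-integrable `]0, (t j)[ (Linf_at f).
  by apply: integrableS (source_Linf_integrable sf) => //; exact: T_sub.
exact: (integrable_fine _ iL).
Qed.

Let n_ge0 s : 0 <= n s.
Proof. exact/fine_ge0/Linf_norm_ge0. Qed.

Let c_ge0 j : 0 <= c j.
Proof.
by rewrite addr_ge0//; [exact/fine_ge0/Linf_norm_ge0|exact: Rintegral_ge0].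
Qed.

Let cE j : (j <= J)%N ->
  (c j)%:E = (Linf_norm u0 + \int[leb]_(s in `]0%R, (t j)[) Linf_norm (f^~ s))%E.
Proof.
move=> jJ; have iL : leb.-integrable `]0, (t j)[ (Linf_at f).
  by apply: integrableS (source_Linf_integrable sf) => //; exact: T_sub.
rewrite /c EFinD (Rintegral_fine _ iL)// !fineK//.
  exact: integrable_fin_num.
by rewrite ge0_fin_numE ?L1_Linf_lty// Linf_norm_ge0.
Qed.

Let c_le_M j : (j <= J)%N -> c j <= M.
Proof.
move=> jJ; rewrite -lee_fin cE//; apply: le_trans supM; rewrite leeD2l//.
apply: ge0_subset_integral => //.
- exact: measurable_int (source_Linf_integrable sf).
- by move=> s _; exact: Linf_norm_ge0.
- exact: T_sub.
Qed.

Let c_step j : (1 <= j <= J)%N -> c j = c j.-1 + \int[leb]_(s in slab j) n s.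
Proof.
move=> jJ; have /andP[_ jJ1] := jJ.
rewrite /c (Rintegral_itv_cat (grid_ge0 grid _) (grid_lt grid jJ)) ?addrA//.
  exact: leq_trans (leq_pred _) jJ1.
exact: in_.
Qed.

Let n_strip j : (1 <= j <= J)%N -> strip_mfun (slab j) (fun _ s => n s).
Proof.
move=> jJ; apply: (measurable_comp (F := slab j) (f := n) (g := snd)) => //.
- by move=> _ [p [_ ps] <-].
- apply: measurableT_comp; first exact: fine_measurable.
  apply: measurable_funS (measurable_int _ (source_Linf_integrable sf)) => //.
  by move=> s; exact: (slab_sub grid jJ).
- exact: measurable_funTS measurable_snd.
Qed.

Let n_integrable j : (1 <= j <= J)%N -> leb.-integrable (slab j) (EFin \o n).
Proof.
move=> jJ; have iL : leb.-integrable (slab j) (Linf_at f).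
  by apply: integrableS (source_Linf_integrable sf) => //; exact: (slab_sub grid jJ).
exact: (integrable_fine _ iL).
Qed.

Let f_strip j : (1 <= j <= J)%N -> strip_mfun (slab j) f.
Proof. by move=> jJ; apply: (source_strip sf) => //; exact: (slab_sub grid jJ). Qed.

Let f_integrable j : (1 <= j <= J)%N ->
  \forall x \ae mu, leb.-integrable (slab j) (EFin \o f x).
Proof.
by move=> jJ; apply: (source_ae_integrable sf) => //; exact: (slab_sub grid jJ).
Qed.

(** At almost every time the norm of the slice is finite and bounds [|f x s|] for almost every [x],
    so the integrand vanishes. The instances of [k] are [a - b] for the upper barrier and [- b - a]
    for the lower one. *)
Let slab_excess j (k : R -> R -> R) : (1 <= j <= J)%N ->
  strip_mfun (slab j) (fun x s => k (f x s) (n s)) ->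
  (forall a b, `|a| <= b -> k a b <= 0) ->
  (\int[leb]_(s in slab j) \int[mu]_x (Num.max (k (f x s) (n s)) 0)%:E = 0)%E.
Proof.
move=> jJ mk k0; have sub := slab_sub grid jJ.
pose h (p : 'rV[R]_N * measurableTypeR R) := (Num.max (k (f p.1 p.2) (n p.2)) 0)%:E.
have mh : measurable_fun ([set: 'rV[R]_N] `*` slab j) h.
  by apply/measurable_EFinP; exact: measurable_maxr.
have h0 p : (0 <= h p)%E by rewrite lee_fin le_max lexx orbT.
have mI := measurable_strip_integral2 mu (mslab j) mh h0.
rewrite (ae_eq_integral (cst 0%E))//; first by rewrite integral0.
have iL : leb.-integrable (slab j) (Linf_at f).
  exact: integrableS (source_Linf_integrable sf).
apply: filterS (integrable_ae (mslab j) iL) => s /= /[swap] js /(_ js) Lfin.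
apply/eqP; rewrite eq_le integral_ge0 ?andbT; last first.
  by move=> x _; exact: (h0 (x, s)).
apply/integral_max0_eq0P; first exact: (measurable_time_section (mslab j) mk).
have /Linf_norm_le := lexx (Linf_norm (f^~ s)).
by apply: filterS => x; rewrite -[leRHS]fineK// lee_fin; exact: k0.
Qed.

(** Induction on the level: the bound [c j], being at most [M], gives access to the CFL condition in
    the next step, in which the solution is compared with the barriers [c] and [- c], driven by the
    sources [n] and [- n]. *)
Lemma solution_ae_le j : (j <= J)%N -> \forall x \ae mu, `|W j x| <= c j.
Proof.
elim: j => [_|j IH jJ].
  have /Linf_norm_le := lexx (Linf_norm u0).
  apply: filterS2 solution0_ae => x ->.
  rewrite -[leRHS]fineK; last first.
    by rewrite ge0_fin_numE ?L1_Linf_lty// Linf_norm_ge0.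
  rewrite lee_fin => /le_trans; apply.
  by rewrite lerDl; exact: Rintegral_ge0.
have jJ1 : (1 <= j.+1 <= J)%N by [].
have {}IH := IH (ltnW jJ).
have WM : \forall x \ae mu, `|W j x| <= M.
  by apply: filterS IH => x /le_trans; apply; exact/c_le_M/ltnW.
have cM (a : R) : `|a| = c j -> \forall x \ae mu, `|a| <= M.
  by move=> ->; apply: nearW => _; exact/c_le_M/ltnW.
(* Of a barrier only the part [(- c)^+] has to be integrable, and it vanishes since [c] is
   nonnegative. *)
have i0 (a : R) : a <= 0 -> mu.-integrable setT (fun=> (Num.max a 0)%:E).
  by move=> a0; rewrite max_r//; exact: integrable0.
have mW i : (i <= J)%N -> measurable_fun setT (W i).
  by move=> /solution_bounded[].
have up : \forall x \ae mu, W j.+1 x - c j.+1 <= 0.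
  apply/integral_max0_eq0P; first by apply: measurable_funB => //; exact: mW.
  apply: le_trans (slab_step (B := fun i _ => c i) (g := fun _ s => n s)
    hphi1 hphi2 grid cphi1 cfl jJ1 _ _ _ _ _ _ _ _ _) _.
  - exact: f_strip.
  - exact: n_strip.
  - exact: f_integrable.
  - by apply: nearW => _; exact: n_integrable.
  - move=> i iJ; split.
    + exact: solution_bounded.
    + exact: bounded_mfun_cst.
    + exact/integrable_max0/solution_integrable.
    + by apply: i0; rewrite oppr_le0.
  - exact: WM.
  - by apply: cM; rewrite ger0_norm.
  - exact: solution_step.
  - exact/scheme_step_cst/c_step.
  rewrite (slab_excess (k := fun a b => a - b))//; last 2 first.
  - by apply: measurable_funB; [exact: f_strip|exact: n_strip].
  - by move=> a b ab; rewrite subr_le0 (le_trans (ler_norm _)).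
  rewrite adde0; apply/integral_max0_eq0P.
    by apply: measurable_funB => //; exact: (mW j (ltnW jJ)).
  by apply: filterS IH => x; rewrite subr_le0; exact/le_trans/ler_norm.
have dn : \forall x \ae mu, - c j.+1 - W j.+1 x <= 0.
  apply/integral_max0_eq0P; first by apply: measurable_funB => //; exact: mW.
  apply: le_trans (slab_step (A := fun i _ => - c i) (f := fun _ s => - n s)
    (B := W) (g := f)
    hphi1 hphi2 grid cphi1 cfl jJ1 _ _ _ _ _ _ _ _ _) _.
  - by apply: measurableT_comp => //; exact: n_strip.
  - exact: f_strip.
  - apply: nearW => _; have := integrableN (n_integrable jJ1).
    exact: eq_integrable.
  - exact: f_integrable.
  - move=> i iJ; split.
    + exact: bounded_mfun_cst.
    + exact: solution_bounded.
    + by apply: i0; rewrite oppr_le0.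
    + exact/integrable_maxN0/solution_integrable.
  - by apply: cM; rewrite normrN ger0_norm.
  - exact: WM.
  - apply: scheme_step_cst => //; rewrite c_step// opprD; congr (_ + _).
    under [RHS]eq_Rintegral do rewrite -mulN1r.
    by rewrite RintegralZl ?mulN1r//; exact: n_integrable.
  - exact: solution_step.
  rewrite (slab_excess (k := fun a b => - b - a))//; last 2 first.
  - apply: measurable_funB; last exact: f_strip.
    by apply: measurableT_comp => //; exact: n_strip.
  - by move=> a b; rewrite ler_norml => /andP[? _]; rewrite subr_le0.
  rewrite adde0; apply/integral_max0_eq0P.
    by apply: measurable_funB => //; exact: (mW j (ltnW jJ)).
  by apply: filterS IH => x; rewrite subr_le0 ler_norml => /andP[].
by apply: filterS2 up dn => x; rewrite !subr_le0 ler_norml => -> ->.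
Qed.

Lemma solution_ae_le_M j : (j <= J)%N -> \forall x \ae mu, `|W j x| <= M.
Proof.
move=> jJ; apply: filterS (solution_ae_le jJ) => x /le_trans; apply.
exact: c_le_M.
Qed.

Lemma Linf_stability j : (j <= J)%N ->
  (Linf_norm (U j) <= Linf_norm u0 +
    \int[leb]_(s in `]0%R, (t j)[) Linf_norm (f^~ s))%E.
Proof.
move=> jJ; rewrite -cE//; apply/Linf_norm_le.
by apply: filterS2 (solution_ae jJ) (solution_ae_le jJ) => x -> ?; rewrite lee_fin.
Qed.

End one_solution.

(** * Monotonicity *)

Section two_solutions.
Context (u0 v0 : 'rV[R]_N -> R) (f g : 'rV[R]_N -> R -> R).
Context (U V : nat -> 'rV[R]_N -> R).
Hypotheses (Lu0 : L1_Linf u0) (Lv0 : L1_Linf v0).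
Hypotheses (sf : source_term T f) (sg : source_term T g).
Hypothesis solU : scheme_solution J t nu1 nu2 phi1 phi2 u0 f U.
Hypothesis solV : scheme_solution J t nu1 nu2 phi1 phi2 v0 g V.
Hypothesis supMf : (sup_bound T u0 f <= M%:E)%E.
Hypothesis supMg : (sup_bound T v0 g <= M%:E)%E.

(** The sources are ordered almost everywhere in space-time, so the iterated integral is turned back
    into one over the product. *)
Let slab_ordered j : (1 <= j <= J)%N ->
  (\forall p \ae (mu \x leb)%E, 0 < p.2 < T -> f p.1 p.2 <= g p.1 p.2) ->
  (\int[leb]_(s in slab j) \int[mu]_x (Num.max (f x s - g x s) 0)%:E = 0)%E.
Proof.
move=> jJ fg; have sub := slab_sub grid jJ.
pose h (p : 'rV[R]_N * measurableTypeR R) := (Num.max (f p.1 p.2 - g p.1 p.2) 0)%:E.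
have mh : measurable_fun ([set: 'rV[R]_N] `*` slab j) h.
  apply/measurable_EFinP; apply: measurable_maxr => //.
  by apply: measurable_funB; [exact: (source_strip sf)|exact: (source_strip sg)].
have h0 p : (0 <= h p)%E by rewrite lee_fin le_max lexx orbT.
rewrite -(strip_tonelli_prod mu leb (mslab j) mh h0).
rewrite (ae_eq_integral (cst 0%E))//; first by rewrite integral0.
  exact: measurableX.
case: fg => A [mA A0 fgA]; exists A; split => // p np; apply: fgA => fgp.
apply: np => -[_ /sub]; rewrite /= in_itv/= => /fgp fgp'.
by rewrite /h max_r// subr_le0.
Qed.

(** The integral of the positive part of the difference is 0 initially, and by [slab_ordered] no
    slab adds to it. *)
Lemma monotonicity : (\forall x \ae mu, u0 x <= v0 x) ->
  (\forall p \ae (mu \x leb)%E, 0 < p.2 < T -> f p.1 p.2 <= g p.1 p.2) ->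
  forall j, (j <= J)%N -> \forall x \ae mu, U j x <= V j x.
Proof.
move=> uv fg j jJ.
have bU i (iJ : (i <= J)%N) := solution_bounded solU iJ.
have bV i (iJ : (i <= J)%N) := solution_bounded solV iJ.
have mUV i : (i <= J)%N -> measurable_fun setT (fun x => clip (U i) x - clip (V i) x).
  by move=> iJ; have [] := bounded_mfunB (bU _ iJ) (bV _ iJ).
suff : \forall x \ae mu, clip (U j) x - clip (V j) x <= 0.
  apply: filterS3 (solution_ae solU jJ) (solution_ae solV jJ) => x -> ->.
  by rewrite subr_le0.
elim: j jJ => [_|j IH jJ].
  apply: filterS3 (solution0_ae solU) (solution0_ae solV) uv => x -> ->.
  by rewrite subr_le0.
have jJ1 : (1 <= j.+1 <= J)%N by [].
apply/integral_max0_eq0P; first exact: mUV.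
apply: le_trans (slab_step (A := fun i => clip (U i)) (B := fun i => clip (V i))
  (f := f) (g := g) hphi1 hphi2 grid cphi1 cfl jJ1 _ _ _ _ _ _ _ _ _) _.
- by apply: (source_strip sf) => //; exact: (slab_sub grid jJ1).
- by apply: (source_strip sg) => //; exact: (slab_sub grid jJ1).
- by apply: (source_ae_integrable sf) => //; exact: (slab_sub grid jJ1).
- by apply: (source_ae_integrable sg) => //; exact: (slab_sub grid jJ1).
- move=> i iJ; split; [exact: bU|exact: bV| |].
  + exact/integrable_max0/(solution_integrable solU).
  + exact/integrable_maxN0/(solution_integrable solV).
- exact: (solution_ae_le_M Lu0 sf solU supMf (ltnW jJ)).
- exact: (solution_ae_le_M Lv0 sg solV supMg (ltnW jJ)).
- exact: (solution_step solU jJ1).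
- exact: (solution_step solV jJ1).
rewrite slab_ordered// adde0; apply/integral_max0_eq0P; first exact: (mUV j (ltnW jJ)).
exact: (IH (ltnW jJ)).
Qed.

End two_solutions.

(** * The L1 bound and conservation of mass *)

Section stability_of_one.
Context (u0 : 'rV[R]_N -> R) (f : 'rV[R]_N -> R -> R) (U : nat -> 'rV[R]_N -> R).
Hypothesis Lu0 : L1_Linf u0.
Hypothesis sf : source_term T f.
Hypothesis solU : scheme_solution J t nu1 nu2 phi1 phi2 u0 f U.

Let mU i : (i <= J)%N -> measurable_fun setT (clip (U i)).
Proof. by move=> /(solution_bounded solU)[]. Qed.

Let L1_clip j : (j <= J)%N -> L1_norm (U j) = L1_norm (clip (U j)).
Proof.
move=> jJ; rewrite !L1_normE; apply: ae_eq_integral => //.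
- apply/measurable_EFinP; apply: measurableT_comp => //.
  by case: solU => LU _ _; exact: L1_Linf_measurable (LU _ jJ).
- by apply/measurable_EFinP; apply: measurableT_comp => //; exact: mU.
- by apply: filterS (solution_ae solU jJ) => x -> _.
Qed.

Let L1_init : L1_norm (clip (U 0%N)) = L1_norm u0.
Proof.
rewrite !L1_normE; apply: ae_eq_integral => //.
- by apply/measurable_EFinP; apply: measurableT_comp => //; exact: mU.
- by apply/measurable_EFinP; apply: measurableT_comp => //; exact: L1_Linf_measurable.
- by apply: filterS (solution0_ae solU) => x -> _.
Qed.

(** Comparison with the zero solution from both sides controls the positive and the negative part of
    the solution; the sum of the two estimates is the L1 bound over one slab. *)
Lemma L1_stability : (sup_bound T u0 f <= M%:E)%E -> forall j, (j <= J)%N ->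
  (L1_norm (U j) <= L1_norm u0 +
    \int[leb]_(s in `]0%R, (t j)[) L1_norm (f^~ s))%E.
Proof.
move=> supM j jJ; rewrite L1_clip// -L1_init.
elim: j jJ => [_|j IH jJ].
  by rewrite leeDl// integral_ge0// => s _; exact: L1_norm_ge0.
have jJ1 : (1 <= j.+1 <= J)%N by [].
have sub := slab_sub grid jJ1.
have mfs := source_strip sf (mslab j.+1) sub.
have mL : measurable_fun `]0, T[ (fun s : measurableTypeR R => L1_norm (f^~ s)).
  by apply: measurable_L1_norm; [exact: measurable_itv|exact: sf.1].
have tjT : `]0, (t j.+1)[ `<=` `]0, T[.
  move=> s /=; rewrite !in_itv/= => /andP[-> st]/=.
  exact: lt_le_trans (grid_leT grid jJ).
have tjj := ltW (grid_lt grid jJ1).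
rewrite (ge0_integral_itv_cat (grid_ge0 grid (ltnW jJ)) tjj)//; last 2 first.
- exact: measurable_funS mL.
- by move=> s; exact: L1_norm_ge0.
rewrite addeA; apply: le_trans (leeD2r _ (IH (ltnW jJ))).
(* This places the zero solution in the range where the CFL condition is available. *)
have M0 : 0 <= M.
  rewrite -lee_fin; apply: le_trans supM; rewrite adde_ge0 ?Linf_norm_ge0//.
  by apply: integral_ge0 => s _; exact: Linf_norm_ge0.
have b0 : bounded_mfun (fun _ : 'rV[R]_N => 0 : R) by exact: bounded_mfun_cst.
have i0 : mu.-integrable setT (fun=> (Num.max (0 : R) 0)%:E).
  by rewrite max_r//; exact: integrable0.
have i0N : mu.-integrable setT (fun=> (Num.max (- 0 : R) 0)%:E).
  by rewrite oppr0.
have step0 : step (fun _ _ => 0) j.+1 (fun _ _ => 0).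
  apply: (scheme_step_cst (n := fun=> 0) (c := fun=> 0)) => //.
  by rewrite Rintegral_cst// mul0r addr0.
pose z (_ : 'rV[R]_N) (_ : R) : R := 0.
have m0 : strip_mfun (slab j.+1) z by exact: measurable_cst.
have ae0 : \forall x \ae mu, `|0 : R| <= M by apply: nearW => _; rewrite normr0.
have fI := source_ae_integrable sf (mslab j.+1) sub.
have zI : \forall x \ae mu, leb.-integrable (slab j.+1) (EFin \o z x).
  by apply: nearW => x; exact: integrable0.
have UM := solution_ae_le_M Lu0 sf solU supM (ltnW jJ).
have bU i (iJ : (i <= J)%N) := solution_bounded solU iJ.
have iU i (iJ : (i <= J)%N) := solution_integrable solU iJ.
have stepU := solution_step solU jJ1.
have Hp := slab_step (A := fun i => clip (U i)) (B := fun _ _ => 0)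
  (g := z) hphi1 hphi2 grid cphi1 cfl jJ1 mfs m0 fI zI
  (fun i iJ => And4 (bU i iJ) b0 (integrable_max0 (iU i iJ)) i0N) UM ae0 stepU step0.
have Hm := slab_step (A := fun _ _ => 0) (B := fun i => clip (U i)) (f := z)
   hphi1 hphi2 grid cphi1 cfl jJ1 m0 mfs zI fI
  (fun i iJ => And4 b0 (bU i iJ) i0 (integrable_maxN0 (iU i iJ))) ae0 UM step0 stepU.
rewrite !L1_normE !integral_normE//; [|exact: (mU (ltnW jJ))|exact: (mU jJ)].
apply: le_trans (leeD Hp Hm) _.
(* After regrouping, the two terms at the previous level coincide with its norm, and the two source
   terms recombine into the L1 norms of the slices. *)
rewrite addeACA leeD2l//.
have mk k : measurable_fun ([set: 'rV[R]_N] `*` slab j.+1)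
    (fun p : 'rV[R]_N * measurableTypeR R => (Num.max (k (f p.1 p.2)) 0)%:E) ->
    measurable_fun (slab j.+1) (fun s => \int[mu]_x (Num.max (k (f x s)) 0)%:E)%E.
  move=> mk; apply: (measurable_strip_integral2 mu (mslab j.+1) mk) => p.
  by rewrite lee_fin le_max lexx orbT.
rewrite -ge0_integralD//.
- rewrite le_eqVlt; apply/orP; left; apply/eqP; apply: eq_integral => s /[!inE] js.
  by rewrite L1_normE integral_normE//; exact: (measurable_time_section (mslab _) mfs).
- by move=> s _; apply: integral_ge0 => x _; rewrite lee_fin le_max lexx orbT.
- apply: (mk (fun a => a - 0)); apply/measurable_EFinP; apply: measurable_maxr => //.
  exact: measurable_funB.
- by move=> s _; apply: integral_ge0 => x _; rewrite lee_fin le_max lexx orbT.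
- apply: (mk (fun a => 0 - a)); apply/measurable_EFinP; apply: measurable_maxr => //.
  exact: measurable_funB.
Qed.

(** One step of the scheme is integrated in space: local Lipschitz continuity makes the jump terms
    integrable with integral 0, and Fubini rewrites the source term. *)
Lemma conservation : locally_lipschitz phi1 -> locally_lipschitz phi2 ->
  forall j, (j <= J)%N ->
  \int[mu]_x U j x = \int[mu]_x u0 x +
    \int[leb]_(s in `]0, (t j)[) \int[mu]_x f x s.
Proof.
move=> lphi1 lphi2 j jJ.
have -> : \int[mu]_x U j x = \int[mu]_x clip (U j) x.
  congr fine; apply: ae_eq_integral => //.
  - apply/measurable_EFinP.
    by case: solU => LU _ _; exact: L1_Linf_measurable (LU _ jJ).
  - by apply/measurable_EFinP; exact: mU.
  - by apply: filterS (solution_ae solU jJ) => x -> _.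
have -> : \int[mu]_x u0 x = \int[mu]_x clip (U 0%N) x.
  congr fine; apply: ae_eq_integral => //.
  - by apply/measurable_EFinP; exact: L1_Linf_measurable.
  - by apply/measurable_EFinP; exact: mU.
  - by apply: filterS (solution0_ae solU) => x -> _.
elim: j jJ => [_|j IH jJ].
  by case: grid => -> _ _; rewrite set_itvoo0 Rintegral_set0 addr0.
have jJ1 : (1 <= j.+1 <= J)%N by [].
have sub := slab_sub grid jJ1.
have tjT : `]0, (t j.+1)[ `<=` `]0, T[.
  move=> s /=; rewrite !in_itv/= => /andP[-> st]/=.
  exact: lt_le_trans (grid_leT grid jJ).
rewrite (Rintegral_itv_cat (grid_ge0 grid (ltnW jJ)) (grid_lt grid jJ1)); last first.
  by apply: (source_time_integrable sf) => //; exact: measurable_itv.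
rewrite addrA -IH ?(ltnW jJ)// -(source_fubini sf (mslab j.+1) sub).
have iF := source_space_integrable sf (mslab j.+1) sub.
have [iJ1 J1] := jump_op_homo_integrable nu1 hphi1 lphi1
  (solution_bounded solU jJ) (solution_integrable solU jJ).
have [iJ2 J2] := jump_op_homo_integrable nu2 hphi2 lphi2
  (solution_bounded solU (ltnW jJ)) (solution_integrable solU (ltnW jJ)).
have iU := solution_integrable solU (ltnW jJ).
pose tau := time_step t j.+1.
have tau0 : tau != 0 by rewrite gt_eqF// (time_step_gt0 grid).
(* The right-hand side of the scheme with the time step distributed: it cancels the normalisation of
   the mean, and each summand is integrable on its own. *)
pose G x := clip (U j) x + (\int[leb]_(s in slab j.+1) f x s +
  (tau * jump_op nu1 (phi1 \o clip (U j.+1)) x +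
   tau * jump_op nu2 (phi2 \o clip (U j)) x)).
have iJ12 := integrableDr (integrableZr_EFin tau iJ1) (integrableZr_EFin tau iJ2).
have iFJ := integrableDr iF iJ12.
have iG : mu.-integrable setT (EFin \o G) := integrableDr iU iFJ.
transitivity (\int[mu]_x G x).
  congr fine; apply: ae_eq_integral => //.
  - by apply/measurable_EFinP; exact: mU.
  - exact: measurable_int iG.
  apply: filterS (solution_step solU jJ1) => x -> _; congr EFin.
  rewrite /G /source_mean -/tau /= !mulrDr mulrA divff// mul1r.
  by congr (_ + _); rewrite addrC.
rewrite /G RintegralD// RintegralD// RintegralD//; last 2 first.
- exact: (integrableZr_EFin tau iJ1).
- exact: (integrableZr_EFin tau iJ2).
rewrite !RintegralZl//.
have -> : \int[mu]_x jump_op nu1 (phi1 \o clip (U j.+1)) x = 0 by rewrite /Rintegral J1.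
have -> : \int[mu]_x jump_op nu2 (phi2 \o clip (U j)) x = 0 by rewrite /Rintegral J2.
by rewrite !mulr0 !addr0.
Qed.

End stability_of_one.

End stability.

(** Ensures that [fine], in the definition of [M] inside [admissible], is not applied to an infinite
    value. *)
Lemma sup_bound_fin_num (R : realType) (N : nat) (T : R) (u0 : 'rV[R]_N -> R)
    (f : 'rV[R]_N -> R -> R) : L1_Linf u0 -> source_term T f ->
  sup_bound T u0 f \is a fin_num.
Proof.
move=> Lu0 sf; rewrite fin_numD ge0_fin_numE ?Linf_norm_ge0// L1_Linf_lty//=.
exact: (integrable_fin_num _ (source_Linf_integrable sf)).
Qed.

Theorem theorem2p6 (R : realType) (N : nat) (T : R) (J : nat) (t : nat -> R)
    (nu1 nu2 : {finite_measure set 'rV[R]_N -> \bar R}) (phi1 phi2 : R -> R)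
    (u0 v0 : 'rV[R]_N -> R) (f g : 'rV[R]_N -> R -> R)
    (U V : nat -> 'rV[R]_N -> R) :
  0 < T ->
  time_grid T J t ->
  L1_Linf u0 -> L1_Linf v0 ->
  source_term T f -> source_term T g ->
  admissible T J t nu1 nu2 phi1 phi2 u0 v0 f g ->
  scheme_solution J t nu1 nu2 phi1 phi2 u0 f U ->
  scheme_solution J t nu1 nu2 phi1 phi2 v0 g V ->
  forall j : nat, (1 <= j <= J)%N ->
  [/\ (\forall x \ae lebesgue_rV R N, u0 x <= v0 x) ->
      (\forall p \ae (lebesgue_rV R N \x @lebesgue_measure R)%E,
        0 < p.2 < T -> f p.1 p.2 <= g p.1 p.2) ->
      \forall x \ae lebesgue_rV R N, U j x <= V j x,
      (L1_norm (U j) <= L1_norm u0 +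
        \int[lebesgue_measure]_(s in `]0%R, (t j)[) L1_norm (f^~ s))%E,
      (Linf_norm (U j) <= Linf_norm u0 +
        \int[lebesgue_measure]_(s in `]0%R, (t j)[) Linf_norm (f^~ s))%E &
      locally_lipschitz phi1 ->
      \int[lebesgue_rV R N]_x U j x = \int[lebesgue_rV R N]_x u0 x +
        \int[lebesgue_measure]_(s in `]0%R, (t j)[)
          \int[lebesgue_rV R N]_x f x s].
Proof.
move=> T0 grid Lu0 Lv0 sf sg [_ [hphi1 cphi1] [hphi2 lphi2]].
set M := fine _ => cflM solU solV j /andP[_ jJ].
have Sf := sup_bound_fin_num Lu0 sf; have Sg := sup_bound_fin_num Lv0 sg.
have Smax : Order.max (sup_bound T u0 f) (sup_bound T v0 g) \is a fin_num.
  by case: leP.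
have supMf : (sup_bound T u0 f <= M%:E)%E by rewrite fineK// le_max lexx.
have supMg : (sup_bound T v0 g <= M%:E)%E by rewrite fineK// le_max lexx orbT.
have cfl i r s : (1 <= i <= J)%N -> `|r| <= M -> `|s| <= M ->
    time_step t i * fine (nu2 setT) * `|phi2 r - phi2 s| <= `|r - s|.
  by move=> iJ; exact: (cfl_pointwise grid iJ cflM).
have cphi10 : {for 0, continuous phi1} by exact: cphi1.
split.
- move=> uv fg.
  exact: (monotonicity grid hphi1 cphi10 hphi2 cfl Lu0 Lv0 sf sg solU solV).
- exact: (L1_stability grid hphi1 cphi10 hphi2 cfl Lu0 sf solU supMf jJ).
- exact: (Linf_stability grid hphi1 cphi10 hphi2 cfl Lu0 sf solU supMf jJ).
- move=> lphi1.
  exact: (conservation grid hphi1 hphi2 Lu0 sf solU lphi1 lphi2 jJ).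
Qed.
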